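(* Let $T$ be an almost Horn theory in a language $\mathcal L$ and let $\mathcal N$ be a weak $T$-on. Define $\mathcal N'_P=D(\mathcal N_P)$ for every $P\in\mathcal L$. Then $\mathcal N'$ is a strong Borel $T$-on such that $\lambda(\mathcal N_P\triangle\mathcal N'_P)=0$ for every $P\in\mathcal L$. In particular, $p(M,\mathcal N)=p(M,\mathcal N')$ for every finite model $M$ of $T$.
   Context: A language $\mathcal L$ is a finite set of predicate symbols with arities $k(P)\ge1$ (no constants/function symbols; equality allowed); a universal theory is a set of axioms $\forall\vec xF(\vec x)$, $F$ open; structures have vertex set $V(M)$ and relations $R_{P,M}\subseteq V(M)^{k(P)}$. $T$ is canonical if it entails $x_i=x_j\to\neg P(x_1,\dots,x_k)$ for all $P$ of arity $k$, $i<j$; a structure is canonical if no relation contains a tuple with repeated entries. A literal is an atomic formula (positive) or its negation (negative). An almost Horn clause is a disjunction of literals with at most one positive literal not involving equality (any number of positive equality literals allowed). An almost Horn theory is a canonical theory all of whose axioms are (universally quantified) almost Horn clauses. $r(V)$: non-empty finite subsets of $V$; $\mathcal E_V=[0,1]^{r(V)}$ with Lebesgue measure $\lambda$; $\mathcal E_k=\mathcal E_{[k]}$; for injective $\alpha:[k]\to V$, $\alpha^*(x)_A=x_{\alpha(A)}$; diagonal $\mathcal D_V=\{x:\exists i\ne j,\ x_{\{i\}}=x_{\{j\}}\}$. A Euclidean structure $\mathcal N$ assigns to each $P$ a Lebesgue measurable $\mathcal N_P\subseteq\mathcal E_{k(P)}$; it is Borel if each $\mathcal N_P$ is Borel. For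 finite $M$, $R_P(M)$ (resp. $\overline R_P(M)$) is the set of injections $\alpha:[k(P)]\to V(M)$ with $(\alpha(1),\dots)\in R_{P,M}$ (resp. $\notin$), $T_{\mathrm{ind}}(M,\mathcal N)=\bigcap_P\big(\bigcap_{\alpha\in R_P(M)}(\alpha^* )^{-1}(\mathcal N_P)\cap\bigcap_{\alpha\in\overline R_P(M)}(\alpha^* )^{-1}(\mathcal E_{k(P)}\setminus\mathcal N_P)\big)$, $p(M,\mathcal N)=\frac{|V(M)|!}{|\mathrm{Aut}(M)|}\lambda(T_{\mathrm{ind}}(M,\mathcal N))$. A weak $T$-on: $\lambda(T_{\mathrm{ind}}(M,\mathcal N))=0$ for every finite canonical structure $M$ not a model of $T$; a strong $T$-on: $T_{\mathrm{ind}}(M,\mathcal N)\subseteq\mathcal D_{V(M)}$ for every such $M$. For a Lebesgue measurable $A\subseteq[0,1]^d$, a point $x\in[0,1]^d$ is a Lebesgue density point of $A$ if $\lim_{r\to0^+}\lambda(B(x,r)\cap A)/\lambda(B(x,r)\cap[0,1]^d)=1$, where $B(x,r)$ is the $\ell_\infty$-ball of radius $r$ centered at $x$; $D(A)$ denotes the set of density points of $A$ (here $\mathcal E_k$ is identified with $[0,1]^{2^k-1}$). *)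

(* Defs.v *)
From HB Require Import structures.
From mathcomp Require Export all_boot all_order all_algebra perm.
From mathcomp Require Export all_classical all_reals all_analysis.
Export Order.TTheory GRing.Theory Num.Theory.
Export numFieldNormedType.Exports.

Set Implicit Arguments.
Unset Strict Implicit.
Unset Printing Implicit Defensive.

Local Open Scope classical_set_scope.
Local Open Scope ring_scope.

Record language := Language {
  sym :> finType ;
  arity : sym -> nat ;
  arity_gt0 : forall P : sym, (0 < arity P)%N }.

Arguments arity {l} P.

(* Atomic formulas whose variables are x_0, ..., x_(n-1). *)
Inductive atom (L : language) (n : nat) : Type :=
| RelAtom (P : L) (t : 'I_(arity P) -> 'I_n)
| EqAtom (i j : 'I_n).

Arguments RelAtom {L n} P t.
Arguments EqAtom {L n} i j.

Inductive open_formula (L : language) (n : nat) : Type :=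
| Bot
| Atom (a : atom L n)
| Neg (F : open_formula L n)
| And (F G : open_formula L n)
| Or (F G : open_formula L n)
| Imp (F G : open_formula L n).

Arguments Bot {L n}.

(* [existT _ n F] stands for the sentence forall x_0 ... x_(n-1), F. *)
Definition universal_sentence (L : language) := {n : nat & open_formula L n}.

Definition forall_closure (L : language) (n : nat) (F : open_formula L n) :
  universal_sentence L := existT _ n F.

Definition theory (L : language) := set (universal_sentence L).

(* V^k is rendered as 'I_k -> V. *)
Definition structure (L : language) (V : Type) :=
  forall P : L, set ('I_(arity P) -> V).

Definition atom_holds (L : language) (V : Type) (M : structure L V) (n : nat)
    (v : 'I_n -> V) (a : atom L n) : Prop :=
  match a with
  | RelAtom P t => M P (v \o t)
  | EqAtom i j => v i = v j
  end.

Fixpoint holds (L : language) (V : Type) (M : structure L V) (n : nat)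
    (v : 'I_n -> V) (F : open_formula L n) : Prop :=
  match F with
  | Bot => False
  | Atom a => atom_holds M v a
  | Neg F => ~ holds M v F
  | And F G => holds M v F /\ holds M v G
  | Or F G => holds M v F \/ holds M v G
  | Imp F G => holds M v F -> holds M v G
  end.

Definition satisfies (L : language) (V : Type) (M : structure L V)
    (S : universal_sentence L) : Prop :=
  forall v : 'I_(projT1 S) -> V, holds M v (projT2 S).

Definition is_model (L : language) (V : Type) (M : structure L V)
    (T : theory L) : Prop :=
  forall S, T S -> satisfies M S.

Definition entails (L : language) (T : theory L) (S : universal_sentence L) :
    Prop :=
  forall (V : Type) (M : structure L V), is_model M T -> satisfies M S.

Definition canonical_theory (L : language) (T : theory L) : Prop :=
  forall (P : L) (i j : 'I_(arity P)), (i < j)%N ->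
    entails T (forall_closure
      (Imp (Atom (EqAtom i j)) (Neg (Atom (RelAtom P (fun k => k)))))).

Definition canonical_structure (L : language) (V : Type) (M : structure L V) :
    Prop :=
  forall (P : L) (t : 'I_(arity P) -> V), M P t -> injective t.

Record literal (L : language) (n : nat) :=
  Literal { positive : bool ; latom : atom L n }.

Definition literal_formula (L : language) (n : nat) (l : literal L n) :
    open_formula L n :=
  if positive l then Atom (latom l) else Neg (Atom (latom l)).

Definition is_equality (L : language) (n : nat) (a : atom L n) : bool :=
  if a is EqAtom _ _ then true else false.

Definition clause_formula (L : language) (n : nat) (c : seq (literal L n)) :
    open_formula L n :=
  foldr (fun l F => Or (literal_formula l) F) Bot c.

Definition almost_horn_clause (L : language) (n : nat)
    (c : seq (literal L n)) : Prop :=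
  (count (fun l => positive l && ~~ is_equality (latom l)) c <= 1)%N.

Definition almost_horn_theory (L : language) (T : theory L) : Prop :=
  canonical_theory T /\
  forall S, T S -> exists (n : nat) (c : seq (literal L n)),
    almost_horn_clause c /\ S = forall_closure (clause_formula c).

Definition half_open_box (R : realType) (I : finType) (a b : I -> R) :
    set (I -> R) :=
  [set x | forall i, a i < x i <= b i].

Definition box_volume (R : realType) (I : finType) (a b : I -> R) : R :=
  \prod_(i : I) Num.max 0 (b i - a i).

(* Lebesgue outer measure: infimum of the total volume of countable covers by
   boxes. The covers are indexed by an arbitrary D : set nat, not by nat: when
   I is empty every box is the one-point space R^0, of volume 1. On Lebesgue
   measurable sets this is Lebesgue measure. *)
Definition lambda (R : realType) (I : finType) (A : set (I -> R)) : \bar R :=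
  ereal_inf [set s | exists (D : set nat) (a b : nat -> I -> R),
    A `<=` \bigcup_(k in D) half_open_box (a k) (b k) /\
    s = (\esum_(k in D) (box_volume (a k) (b k))%:E)%E].

Definition lebesgue_measurable (R : realType) (I : finType)
    (A : set (I -> R)) : Prop :=
  (@lambda R I).-caratheodory A.

Definition borel_set (R : realType) (I : finType) (A : set (I -> R)) : Prop :=
  <<s [set U : set {ptws I -> R} | open U] >> A.

Definition unit_cube (R : realType) (I : finType) : set (I -> R) :=
  [set x | forall i, 0 <= x i <= 1].

Arguments unit_cube {R I}.

Definition linf_ball (R : realType) (I : finType) (x : I -> R) (r : R) :
    set (I -> R) :=
  [set y | forall i, `|x i - y i| < r].

Definition density_points (R : realType) (I : finType) (A : set (I -> R)) :
    set (I -> R) :=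
  [set x | unit_cube x /\
    (lambda (linf_ball x r `&` A) / lambda (linf_ball x r `&` unit_cube))%E
      @[r --> 0^'+] --> 1%E].

Definition nonempty_subset (V : finType) := {A : {set V} | A != finset.set0}.

(* R^{r(V)}; the space E_V is its subset [unit_cube]. *)
Definition ambient (R : realType) (V : finType) := nonempty_subset V -> R.

Lemma imset_nonempty (U V : finType) (f : U -> V) (A : nonempty_subset U) :
  (f @: val A)%SET != finset.set0.
Proof.
have /set0Pn [x xA] := valP A.
by apply/set0Pn; exists (f x); apply: imset_f.
Qed.

Definition subset_image (U V : finType) (f : U -> V) (A : nonempty_subset U) :
    nonempty_subset V :=
  exist _ (f @: val A)%SET (imset_nonempty f A).

Lemma singleton_nonempty (V : finType) (i : V) :
  ([set i])%SET != finset.set0.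
Proof. by apply/set0Pn; exists i; rewrite finset.inE. Qed.

Definition singleton (V : finType) (i : V) : nonempty_subset V :=
  exist _ ([set i])%SET (singleton_nonempty i).

Definition pullback (R : realType) (k : nat) (V : finType)
    (alpha : 'I_k -> V) (x : ambient R V) : ambient R 'I_k :=
  fun A => x (subset_image alpha A).

Definition diagonal (R : realType) (V : finType) : set (ambient R V) :=
  [set x | unit_cube x /\
    exists i j : V, i <> j /\ x (singleton i) = x (singleton j)].

Arguments diagonal {R V}.

Definition predicate_sets (R : realType) (L : language) :=
  forall P : L, set (ambient R 'I_(arity P)).

Definition euclidean_structure (R : realType) (L : language)
    (N : predicate_sets R L) : Prop :=
  forall P : L, N P `<=` unit_cube /\ lebesgue_measurable (N P).

Definition borel_structure (R : realType) (L : language)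
    (N : predicate_sets R L) : Prop :=
  forall P : L, borel_set (N P).

(* R_P(M) and its complement among the injections [k(P)] -> V(M). *)
Definition pos_injections (L : language) (V : finType) (M : structure L V)
    (P : L) : set ('I_(arity P) -> V) :=
  [set alpha | injective alpha /\ M P alpha].

Definition neg_injections (L : language) (V : finType) (M : structure L V)
    (P : L) : set ('I_(arity P) -> V) :=
  [set alpha | injective alpha /\ ~ M P alpha].

Arguments pos_injections {L V} M P _.
Arguments neg_injections {L V} M P _.

Definition Tind (R : realType) (L : language) (V : finType)
    (M : structure L V) (N : predicate_sets R L) : set (ambient R V) :=
  unit_cube `&` \bigcap_(P in [set: L])
    (\bigcap_(alpha in pos_injections M P) (pullback alpha @^-1` N P) `&`
     \bigcap_(alpha in neg_injections M P)
       (pullback alpha @^-1` (unit_cube `\` N P))).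

Definition automorphisms (L : language) (V : finType) (M : structure L V) :
    {set {perm V}} :=
  [set s : {perm V} |
    `[< forall (P : L) (t : 'I_(arity P) -> V), M P (s \o t) <-> M P t >]]%SET.

Definition density (R : realType) (L : language) (V : finType)
    (M : structure L V) (N : predicate_sets R L) : \bar R :=
  (((#|V|)`!%:R / #|automorphisms M|%:R)%:E * lambda (Tind M N))%E.

Definition weak_on (R : realType) (L : language) (T : theory L)
    (N : predicate_sets R L) : Prop :=
  euclidean_structure N /\
  forall (V : finType) (M : structure L V),
    canonical_structure M -> ~ is_model M T -> lambda (Tind M N) = 0%E.

Definition strong_on (R : realType) (L : language) (T : theory L)
    (N : predicate_sets R L) : Prop :=
  euclidean_structure N /\
  forall (V : finType) (M : structure L V),
    canonical_structure M -> ~ is_model M T -> Tind M N `<=` diagonal.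

(* Main.v *)
Require Import Defs.
From HB Require Import structures.
From mathcomp Require Import measurable_realfun.
From Stdlib Require List.

Set Implicit Arguments.
Unset Strict Implicit.
Unset Printing Implicit Defensive.
Local Open Scope classical_set_scope.
Local Open Scope ring_scope.

(* Given a weak T-on N and a finite V, almost every point of the cube induces on
   V a canonical model of T: the structures on V form a finite set, and those
   that are not models have null T_ind. Now let x lie in T_ind(M, D(N)) for a
   canonical M that violates an almost Horn clause. Near x, the relational
   hypotheses of the clause hold for N outside a set of relative measure tending
   to 0, so by the previous remark its unique relational conclusion, if there is
   one, does too. Without a conclusion this is absurd; with one, it says that
   the corresponding projection of x is a density point, contradicting x in
   T_ind(M, D(N)). Hence T_ind(M, D(N)) is even empty.

   Relative measures are compared between a cube and its coordinate projections
   by a Tonelli inequality for outer measures. The Lebesgue density theorem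
   comes from a Vitali selection of disjoint balls, and D(N) is Borel because
   lambda (B(x, r) `&` A) is continuous in x, which exhibits D(N) as a countable
   intersection of countable unions of closed sets. *)

(** * Products and the outer measure of cylinders *)

Section partial_outer_measure.
Variables (R : realType) (I : finType).
Implicit Types (S : {set I}) (a b x : I -> R) (A : set (I -> R)).

Definition cyl_box S a b : set (I -> R) :=
  [set x | forall i, i \in S -> a i < x i <= b i].

Definition cyl_volume S a b : R := \prod_(i in S) Num.max 0 (b i - a i).

(** This is the outer measure, in the coordinates of [S], of the projection of [A]. Keeping every
    point in [I -> R] lets coordinates be added to [S] one at a time without a change of type. *)
Definition cyl_lambda S A : \bar R :=
  ereal_inf [set s | exists (D : set nat) (a b : nat -> I -> R),
    A `<=` \bigcup_(k in D) cyl_box S (a k) (b k) /\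
    s = (\esum_(k in D) (cyl_volume S (a k) (b k))%:E)%E].

Definition upd x (j : I) (z : R) : I -> R := fun i => if i == j then z else x i.

Lemma cyl_volume_ge0 S a b : 0 <= cyl_volume S a b.
Proof. by apply: prodr_ge0 => i _; rewrite le_max lexx. Qed.

Lemma cyl_lambda_ge0 S A : (0 <= cyl_lambda S A)%E.
Proof.
apply/ereal_infP => _ [D [a [b [_ ->]]]].
by apply: esum_ge0 => k _; rewrite lee_fin cyl_volume_ge0.
Qed.

Lemma cyl_lambda_setT A : cyl_lambda [set: I]%SET A = lambda A.
Proof.
have Eb a b : cyl_box [set: I]%SET a b = half_open_box a b.
  by apply/seteqP; split => x /= h i; [apply: h; rewrite finset.inE|move=> _; apply: h].
have Ev a b : cyl_volume [set: I]%SET a b = box_volume a b.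
  by apply: eq_bigl => i; rewrite finset.inE.
rewrite /cyl_lambda /lambda; congr ereal_inf; apply/seteqP; split => s [D [a [b [h ->]]]];
  exists D, a, b; split.
- by apply: subset_trans h _; apply: subset_bigcup => k _; rewrite Eb.
- by apply: eq_esum => k _; rewrite Ev.
- by apply: subset_trans h _; apply: subset_bigcup => k _; rewrite Eb.
- by apply: eq_esum => k _; rewrite Ev.
Qed.

Lemma cyl_lambda0 A : A !=set0 -> cyl_lambda finset.set0 A = 1%E.
Proof.
move=> [x Ax].
have Ev a b : cyl_volume finset.set0 a b = 1.
  by rewrite /cyl_volume big_pred0// => i; rewrite finset.inE.
apply/eqP; rewrite eq_le; apply/andP; split.
  apply: ge_ereal_inf; exists 1%E => //.
  exists [set 0%N], (fun=> x), (fun=> x); split.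
    by move=> y _; exists 0%N => // i; rewrite finset.inE.
  by rewrite esum_set1 Ev ?lee_fin.
apply/ereal_infP => _ [D [a [b [AD ->]]]].
have [k Dk _] := AD _ Ax.
apply: esum_ge; exists [set k].
  by split; [exact: finite_set1|move=> _ ->].
by rewrite fsbig_set1 Ev.
Qed.

Lemma esum_nat (D : set nat) (c : nat -> R) : (forall k, 0 <= c k) ->
  (\esum_(k in D) (c k)%:E = \sum_(k <oo) (if k \in D then c k else 0)%:E)%E.
Proof.
move=> c0; rewrite esum_mkcond nneseries_esumT.
  by apply: eq_esum => k _; case: (k \in D).
by move=> k; rewrite lee_fin; case: (k \in D).
Qed.

(* A cover of A x ]c, d[ restricts, on each slice at height z, to a cover of A
   by the boxes whose j-th side contains z; integrating over z in ]c, d[ bounds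
   the outer measure of the product from below, without measurability of A. *)
Lemma cyl_lambda_slice S A j (c d : R) : j \notin S ->
  (forall x z, A x -> A (upd x j z)) -> c < d ->
  (cyl_lambda S A * (d - c)%:E
    <= cyl_lambda (j |: S) (A `&` [set x | (c < x j < d)%R]))%E.
Proof.
move=> jS Aj cd; apply/ereal_infP => _ [D [a [b [AD ->]]]].
pose v k := if k \in D then cyl_volume S (a k) (b k) else 0.
have v0 k : 0 <= v k by rewrite /v; case: ifP => // _; exact: cyl_volume_ge0.
pose Y : set R := `]c, d[%classic.
pose E k : set R := `](a k j), (b k j)]%classic.
have mE k : measurable (E k) by exact: measurable_itv.
have mY : measurable Y by exact: measurable_itv.
have EE k z : E k z <-> (a k j < z <= b k j).
  by rewrite /E/= in_itv/=.
have slice z : Y z ->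
    (cyl_lambda S A <= \sum_(k <oo) (v k * \1_(E k) z)%:E)%E.
  move=> Yz; apply: ge_ereal_inf.
  exists (\sum_(k <oo) (v k * \1_(E k) z)%:E)%E => //.
  exists (D `&` [set k | E k z]), a, b; split.
    move=> x Ax; have [k Dk bk] : (\bigcup_(k in D) cyl_box (j |: S) (a k) (b k)) (upd x j z).
      apply: AD; split; first exact: Aj.
      by rewrite /= /upd eqxx; move: Yz; rewrite /Y/= in_itv.
    exists k; first split => //.
      by apply/EE; have := bk j; rewrite finset.in_setU1 eqxx /upd eqxx; apply.
    move=> i iS; have := bk i; rewrite finset.in_setU1 iS orbT /upd.
    by case: eqP => [ij|_]; [move: jS; rewrite -ij iS|apply].
  rewrite esum_nat; last by move=> k; exact: cyl_volume_ge0.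
  apply: eq_eseriesr => k _; rewrite indicE in_setI /v.
  rewrite (_ : (k \in [set k | E k z]) = (z \in E k)); last first.
    by apply/idP/idP; rewrite !inE.
  by case: (k \in D) => /=; case: (z \in E k); rewrite ?(mulr1,mulr0,mul0r).
have mf k : measurable_fun Y (fun z => (v k * \1_(E k) z)%:E).
  apply/measurable_EFinP; apply: measurable_funM => //.
have -> : (cyl_lambda S A * (d - c)%:E =
    \int[lebesgue_measure]_(z in Y) cst (cyl_lambda S A) z)%E.
  rewrite integral_cst//; congr (_ * _)%E.
  by have /= -> := lebesgue_measure_itv `]c, d[; rewrite lte_fin cd EFinB.
apply: (@le_trans _ _ (\int[lebesgue_measure]_(z in Y)
    \sum_(k <oo) (v k * \1_(E k) z)%:E)%E).
  apply: ge0_le_integral => //.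
  - by move=> z _; exact: cyl_lambda_ge0.
  - apply: (@ge0_emeasurable_sum _ _ _ Y (fun k z => (v k * \1_(E k) z)%:E) xpredT) => //.
    by move=> k z _ _; rewrite lee_fin mulr_ge0.
rewrite integral_nneseries//; last first.
  by move=> k z _; rewrite lee_fin mulr_ge0.
rewrite esum_nat; last by move=> k; exact: cyl_volume_ge0.
apply: lee_nneseries => [k _ _|k _].
  by apply: integral_ge0 => z _; rewrite lee_fin mulr_ge0.
under eq_integral do rewrite EFinM.
rewrite ge0_integralZl//; last first.
- by rewrite lee_fin.
- by apply/measurable_EFinP; exact: (measurable_indic (mE k)).
rewrite integral_indic//; last exact: mE.
rewrite /v; case: (k \in D); last by rewrite mul0e.
rewrite /cyl_volume big_setU1//= mulrC EFinM.
apply: lee_wpmul2l; first by rewrite lee_fin cyl_volume_ge0.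
apply: (@le_trans _ _ (lebesgue_measure (E k))).
  apply: le_measure; rewrite ?inE; [|exact: mE|exact: subIsetl].
  by apply: measurableI; [exact: mE|exact: mY].
have /= -> := lebesgue_measure_itv `](a k j), (b k j)].
rewrite lte_fin; case: ltP => h; rewrite -?EFinB lee_fin le_max ?lexx ?orbT//.
Qed.

(** Give every box of a cover of [A] the [j]-th side ]c, d]: this multiplies its volume by [d - c]
    and leaves its sides in [S] unchanged. *)
Lemma cyl_lambda_slab S A j (c d : R) : j \notin S -> c < d ->
  (cyl_lambda (j |: S) (A `&` [set x | (c < x j <= d)%R])
    <= cyl_lambda S A * (d - c)%:E)%E.
Proof.
move=> jS cd; have dc0 : 0 < d - c by rewrite subr_gt0.
rewrite -lee_pdivrMr//; apply/ereal_infP => _ [D [a [b [AD ->]]]].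
rewrite lee_pdivrMr//; apply: ge_ereal_inf.
have cE x z i : i \in S -> upd x j z i = x i.
  by rewrite /upd => iS; case: eqP => // ij; move: jS; rewrite -ij iS.
eexists.
  exists D, (fun k => upd (a k) j c), (fun k => upd (b k) j d); split => //.
  move=> x [/AD[k Dk bk] /= xj]; exists k => // i.
  rewrite finset.in_setU1 => /predU1P[->|iS]; first by rewrite /upd eqxx.
  by rewrite !cE//; exact: bk.
rewrite !esum_nat; try by move=> k; exact: cyl_volume_ge0.
rewrite muleC -nneseriesZl; last first.
  by move=> k _; case: ifP => //; rewrite lee_fin cyl_volume_ge0.
apply: lee_nneseries => [k _ _|k _].
  by case: ifP => //; rewrite lee_fin cyl_volume_ge0.
case: ifP => _; last by rewrite mule0.
rewrite -EFinM lee_fin /cyl_volume big_setU1//= /upd eqxx.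
rewrite max_r ?(ltW dc0)//; rewrite ler_pM2l//.
rewrite le_eqVlt; apply/orP; left; apply/eqP; apply: eq_bigr => i iS.
by rewrite -/(upd (a k) j c i) -/(upd (b k) j d i) !cE.
Qed.

Lemma le_cyl_lambda S A B : A `<=` B -> (cyl_lambda S A <= cyl_lambda S B)%E.
Proof.
move=> AB; apply: ereal_inf_le_tmp => s [D [a [b [h ->]]]].
by exists D, a, b; split => //; apply: subset_trans h.
Qed.

(** The open interval inside [Y] gives the lower bound through [cyl_lambda_slice]. For the upper
    bound [Y] may contain [c], which a half-open side misses, so the slab starts slightly to the
    left of [c]. *)
Lemma cyl_lambda_prod1 S A j (Y : set R) (c d : R) : j \notin S ->
  (forall x z, A x -> A (upd x j z)) -> c < d ->
  `]c, d[ `<=` Y -> Y `<=` `[c, d] ->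
  cyl_lambda S A \is a fin_num ->
  cyl_lambda (j |: S) (A `&` [set x | Y (x j)]) = (cyl_lambda S A * (d - c)%:E)%E.
Proof.
move=> jS Aj cd cdY Ycd Afin; apply/eqP; rewrite eq_le; apply/andP; split; last first.
  apply: le_trans (cyl_lambda_slice jS Aj cd) _.
  apply: le_cyl_lambda => x [Ax /= xj]; split => //.
  by apply: cdY => /=; rewrite in_itv.
rewrite -(fineK Afin) -EFinM; apply/lee_addgt0Pr => e e0.
have M0 : 0 <= fine (cyl_lambda S A) by rewrite fine_ge0// cyl_lambda_ge0.
set M := fine _ in M0 *.
(* Widening by [h] costs [M * h <= e]; the [+ 1] covers [M = 0]. *)
pose h := e / (M + 1); have h0 : 0 < h by rewrite divr_gt0// ltr_wpDl.
have cd' : c - h < d by rewrite (lt_trans _ cd)// ltrBlDr ltrDl.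
apply: (@le_trans _ _ (cyl_lambda S A * (d - (c - h))%:E)%E).
  apply: le_trans (cyl_lambda_slab A jS cd').
  apply: le_cyl_lambda => x [Ax /= /Ycd/=]; rewrite in_itv/= => /andP[cx xd].
  by split => //; rewrite /= xd andbT (lt_le_trans _ cx)// ltrBlDr ltrDl.
rewrite -(fineK Afin) -/M -EFinM -EFinD lee_fin.
have Mh : M * h <= e.
  by rewrite /h mulrCA ler_piMr ?(ltW e0)// ler_pdivrMr ?ltr_wpDl// mul1r lerDl.
by rewrite opprB addrCA mulrDr [leRHS]addrC lerD2r.
Qed.

Definition cylinder S A := forall x y, {in S, x =1 y} -> A x -> A y.

Lemma cyl_lambda_prod S A (Y : I -> set R) (c d : I -> R) (s : seq I) :
  uniq s -> {in s, forall j, j \notin S} -> cylinder S A ->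
  (forall i, c i < d i) ->
  (forall i, `]c i, d i[ `<=` Y i) -> (forall i, Y i `<=` `[c i, d i]) ->
  cyl_lambda S A \is a fin_num ->
  cyl_lambda ([set i in s] :|: S)%SET (A `&` [set x | forall j, j \in s -> Y j (x j)])
    = (cyl_lambda S A * (\prod_(j <- s) (d j - c j))%:E)%E.
Proof.
move=> + + AS cd cdY Ycd Afin; elim: s => [_ _|j s ih /= /andP[js us] sS].
  rewrite big_nil mule1; congr cyl_lambda; last by apply/seteqP; split => x // [].
  by apply/setP => i; rewrite !finset.inE.
have {}ih := ih us (fun i si => sS i (@mem_behead _ (j :: s) _ si)).
rewrite big_cons mulrC EFinM muleA -ih.
rewrite (_ : _ :|: S = j |: ([set i in s] :|: S))%SET; last first.
  by apply/setP => i; rewrite !finset.inE orbA.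
rewrite (_ : A `&` _ = (A `&` [set x | forall j, j \in s -> Y j (x j)])
    `&` [set x | Y j (x j)]); last first.
  apply/seteqP; split => [x [Ax h]|x [[Ax h] h']]; split => //.
  - by split => // i si; apply: h; rewrite inE si orbT.
  - by apply: h; rewrite mem_head.
  - by move=> i; rewrite inE => /predU1P[->//|]; exact: h.
apply: cyl_lambda_prod1 => //.
- by rewrite !finset.inE (negbTE js) (negbTE (sS j (mem_head _ _))).
- move=> x z [Ax h]; split.
    apply: AS Ax => i iS; rewrite /upd; case: eqP => // ij.
    by have := sS j (mem_head _ _); rewrite -ij iS.
  move=> i si; rewrite /= /upd; case: eqP => [ij|_]; last exact: h.
  by move: js; rewrite -ij si.
- by rewrite ih fin_numM.
Qed.

Lemma cyl_lambda_prodT S A (Y : I -> set R) (c d : I -> R) :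
  cylinder S A -> (forall i, c i < d i) ->
  (forall i, `]c i, d i[ `<=` Y i) -> (forall i, Y i `<=` `[c i, d i]) ->
  cyl_lambda S A \is a fin_num ->
  lambda (A `&` [set x | forall j, j \notin S -> Y j (x j)])
    = (cyl_lambda S A * (\prod_(j | j \notin S) (d j - c j))%:E)%E.
Proof.
move=> AS cd cdY Ycd Afin.
have := @cyl_lambda_prod S A Y c d (enum (~: S)%SET) (enum_uniq _) _ AS cd cdY Ycd Afin.
rewrite big_enum/= (eq_bigl (fun j => j \notin S)); last by move=> i; rewrite finset.inE.
move=> <-; last by move=> j; rewrite mem_enum finset.inE.
rewrite -cyl_lambda_setT; congr cyl_lambda.
  by apply/setP => i; rewrite !finset.inE mem_enum finset.inE orNb.
by apply/seteqP; split => x [Ax h]; split => // j jS; apply: h; move: jS;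
  rewrite mem_enum finset.inE.
Qed.

(** All coordinates are adjoined to the empty set of coordinates, over which the whole space has
    partial measure 1. *)
Lemma lambda_prod (Y : I -> set R) (c d : I -> R) :
  (forall i, c i < d i) ->
  (forall i, `]c i, d i[ `<=` Y i) -> (forall i, Y i `<=` `[c i, d i]) ->
  lambda [set x | forall j, Y j (x j)] = (\prod_j (d j - c j))%:E.
Proof.
move=> cd cdY Ycd.
have T0 : cyl_lambda finset.set0 [set: I -> R] = 1%E by apply: cyl_lambda0; exists (fun=> 0).
have := @cyl_lambda_prodT finset.set0 setT Y c d _ cd cdY Ycd.
rewrite T0 mul1e (eq_bigl xpredT); last by move=> i; rewrite finset.inE.
move=> <-//; congr lambda; apply/seteqP; split => x /=.
  by move=> h; split.
by move=> [_ h] j; apply: h; rewrite finset.inE.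
Qed.

End partial_outer_measure.

Lemma cyl_lambda_image (R : realType) (I J : finType) (f : J -> I)
    (A : set (J -> R)) : injective f ->
  cyl_lambda (f @: [set: J])%SET ((fun x : I -> R => x \o f) @^-1` A) = lambda A.
Proof.
move=> finj.
(* Boxes over [J] are carried to boxes over [I] by [ext]. Its value 0 off the image of [f] is never
   inspected by a box over that image. *)
pose ext (y : J -> R) i := if [pick j | f j == i] is Some j then y j else 0.
have extE y j : ext y (f j) = y j.
  rewrite /ext; case: pickP => [k /eqP/finj->//|/(_ j)]; by rewrite eqxx.
have volE a b : cyl_volume (f @: [set: J])%SET a b = box_volume (a \o f) (b \o f).
  rewrite /cyl_volume big_imset/=; last by move=> ? ? _ _; exact: finj.
  by apply: eq_bigl => j; rewrite finset.inE.
apply/eqP; rewrite eq_le; apply/andP; split.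
- apply/ereal_infP => _ [D [a [b [AD ->]]]]; apply: ge_ereal_inf.
  eexists.
    exists D, (ext \o a), (ext \o b); split; last by [].
    move=> x /AD[k Dk bk]; exists k => // _ /imsetP[j _ ->] /=.
    by rewrite !extE; exact: bk.
  apply: le_esum => k _; rewrite volE lee_fin /box_volume.
  by rewrite le_eqVlt; apply/orP; left; apply/eqP/eq_bigr => j _ /=; rewrite !extE.
- apply/ereal_infP => _ [D [a [b [AD ->]]]]; apply: ge_ereal_inf.
  eexists.
    exists D, (fun k => a k \o f), (fun k => b k \o f); split; last by [].
    move=> y Ay; have [|k Dk bk] := AD (ext y).
      by rewrite /preimage/= (_ : ext y \o f = y)//; apply/funext => j /=; rewrite extE.
    exists k => // j; have := bk (f j); rewrite extE; apply.
    by apply: imset_f; rewrite finset.inE.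
  by apply: le_esum => k _; rewrite volE.
Qed.

(** Cross-multiplied equality of relative measures: the preimage fills the same share of the large
    box as [A] does of the projected one. Both sides are [lambda A] times the product of all side
    lengths over [I]. *)
Lemma lambda_preimage_prod (R : realType) (I J : finType) (f : J -> I)
    (A : set (J -> R)) (Y : I -> set R) (c d : I -> R) : injective f ->
  (forall i, c i < d i) ->
  (forall i, `]c i, d i[ `<=` Y i) -> (forall i, Y i `<=` `[c i, d i]) ->
  A `<=` [set y | forall j, Y (f j) (y j)] -> lambda A \is a fin_num ->
  (lambda ((fun x : I -> R => x \o f) @^-1` A `&` [set x | forall i, Y i (x i)])
    * lambda [set y : J -> R | forall j, Y (f j) (y j)]
  = lambda A * lambda [set x | forall i, Y i (x i)])%E.
Proof.
move=> finj cd cdY Ycd AY Afin.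
rewrite (_ : _ `&` _ = (fun x : I -> R => x \o f) @^-1` A `&`
   [set x | forall i, i \notin (f @: [set: J])%SET -> Y i (x i)]); last first.
  apply/seteqP; split => [x [Ax h]|x [Ax h]]; split => // i.
  have [/imsetP[j _ ->]|] := boolP (i \in (f @: [set: J])%SET); last exact: (h i).
  exact: (AY _ Ax).
have E := cyl_lambda_image A finj.
rewrite (cyl_lambda_prodT _ cd cdY Ycd) ?E//; last first.
  move=> x y xy /=; rewrite (_ : x \o f = y \o f)//.
  by apply/funext => j /=; apply: xy; apply: imset_f; rewrite finset.inE.
rewrite (lambda_prod cd cdY Ycd).
rewrite (@lambda_prod R J (Y \o f) (c \o f) (d \o f))//; try by move=> j /=.
rewrite -muleA -EFinM; congr (_ * _%:E)%E.
rewrite [RHS](bigID (fun i => i \in (f @: [set: J])%SET))/= mulrC; congr (_ * _)%R.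
rewrite big_imset/=; last by move=> ? ? _ _; exact: finj.
by apply: eq_bigl => j; rewrite finset.inE.
Qed.

(** * Lebesgue outer measure *)

Section lambda_outer_measure.
Variables (R : realType) (I : finType).
Implicit Types (a b x : I -> R) (A : set (I -> R)).

Lemma box_volume_ge0 a b : 0 <= box_volume a b.
Proof. by apply: prodr_ge0 => i _; rewrite le_max lexx. Qed.

Lemma lambda0 : lambda (set0 : set (I -> R)) = 0%E.
Proof.
apply/eqP; rewrite eq_le -cyl_lambda_setT cyl_lambda_ge0 andbT cyl_lambda_setT.
apply: ge_ereal_inf; exists 0%E => //; exists set0, (fun=> cst 0), (fun=> cst 0).
by split; [exact: sub0set|rewrite esum_set0].
Qed.

Lemma lambda_ge0 A : (0 <= lambda A)%E.
Proof. by rewrite -cyl_lambda_setT cyl_lambda_ge0. Qed.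

Lemma le_lambda : {homo @lambda R I : A B / A `<=` B >-> (A <= B)%E}.
Proof. by move=> A B AB; rewrite -!cyl_lambda_setT; exact: le_cyl_lambda. Qed.

(** Covers may be indexed by any countable type, for instance by pairs when covers of a sequence of
    sets are merged. The default box in [lift] sits at indices outside the image of [D]. *)
Lemma lambda_cover (J : countType) (D : set J) (a b : J -> I -> R) A :
  A `<=` \bigcup_(k in D) half_open_box (a k) (b k) ->
  (lambda A <= \esum_(k in D) (box_volume (a k) (b k))%:E)%E.
Proof.
move=> AD; apply: ge_ereal_inf.
pose lift (c : J -> I -> R) n := if unpickle n is Some k then c k else cst 0.
exists (\esum_(k in D) (box_volume (a k) (b k))%:E)%E => //.
exists (pickle @` D), (lift a), (lift b); split.
  move=> x /AD[k Dk bk]; exists (pickle k); first by exists k.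
  by rewrite /lift pickleK.
rewrite esum_image; last by move=> ? ? _ _; exact: (pcan_inj pickleK).
by apply: eq_esum => k _; rewrite /lift pickleK.
Qed.

Lemma lambda_sigma_subadditive : sigma_subadditive (@lambda R I).
Proof.
move=> F; have [[n Fn]|Ffin] := pselect (exists n, lambda (F n) = +oo%E).
  rewrite (@nneseries_pinfty _ _ xpredT n)// ?leey// => k _; exact: lambda_ge0.
have {}Ffin n : lambda (F n) \is a fin_num.
  rewrite ge0_fin_numE ?lambda_ge0// ltey; apply/eqP => h.
  by apply: Ffin; exists n.
apply/lee_addgt0Pr => e e0.
apply: le_trans (epsilon_trick _ _ (ltW e0)); last by move=> n; exact: lambda_ge0.
have /choice[cov covP] n : exists c : set nat * (nat -> I -> R) * (nat -> I -> R),
    F n `<=` \bigcup_(k in c.1.1) half_open_box (c.1.2 k) (c.2 k) /\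
    (\esum_(k in c.1.1) (box_volume (c.1.2 k) (c.2 k))%:E
      <= lambda (F n) + (e / (2 ^ n.+1)%:R)%:E)%E.
  have en0 : 0 < e / (2 ^ n.+1)%:R by rewrite divr_gt0// ltr0n expn_gt0.
  have [s [D [a [b [FD ->]]]] h] := lb_ereal_inf_adherent en0 (Ffin n).
  by exists (D, a, b); split => //; exact: ltW.
apply: (@le_trans _ _ (\esum_(k in [set: nat] `*`` (fun n => (cov n).1.1))
    (box_volume ((cov k.1).1.2 k.2) ((cov k.1).2 k.2))%:E)%E).
  apply: lambda_cover => x [n _ /(covP n).1[k Dk bk]].
  by exists (n, k).
rewrite -(@esum_esum _ _ _ setT (fun n => (cov n).1.1)
   (fun n k => (box_volume ((cov n).1.2 k) ((cov n).2 k))%:E)); last first.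
  by move=> n k _ _; rewrite lee_fin box_volume_ge0.
rewrite -nneseries_esumT; last first.
  by move=> n; apply: esum_ge0 => k _; rewrite lee_fin box_volume_ge0.
apply: lee_nneseries => n _; last exact: (covP n).2.
by move=> _; apply: esum_ge0 => k _; rewrite lee_fin box_volume_ge0.
Qed.

HB.instance Definition _ := isOuterMeasure.Build R (I -> R) (@lambda R I)
  lambda0 lambda_ge0 le_lambda lambda_sigma_subadditive.

Lemma bigcup_unpickle (J : countType) (T : Type) (F : J -> set T) :
  \bigcup_j F j = \bigcup_n (if unpickle n is Some j then F j else set0).
Proof.
apply/seteqP; split => x [j _ Fx].
  by exists (pickle j) => //; rewrite pickleK.
by move: Fx; case: (unpickle j) => // k Fx; exists k.
Qed.

Lemma lambda_null_bigcup (J : countType) (F : J -> set (I -> R)) :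
  (forall j, lambda (F j) = 0%E) -> lambda (\bigcup_j F j) = 0%E.
Proof.
move=> F0; apply/eqP; rewrite eq_le lambda_ge0 andbT bigcup_unpickle.
apply: le_trans (lambda_sigma_subadditive _) _.
rewrite eseries0// => n _ _; case: (unpickle n) => [j|]; [exact: F0|exact: lambda0].
Qed.

Lemma lambda_nullS A B : A `<=` B -> lambda B = 0%E -> lambda A = 0%E.
Proof.
by move=> AB B0; apply/eqP; rewrite eq_le lambda_ge0 andbT -B0 le_lambda.
Qed.

Lemma lambda_nullU A B : lambda A = 0%E -> lambda B = 0%E -> lambda (A `|` B) = 0%E.
Proof.
move=> A0 B0; apply/eqP; rewrite eq_le lambda_ge0 andbT.
by apply: le_trans (outer_measureU2 _ _ _) _; rewrite /= A0 B0 adde0.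
Qed.

Lemma lebesgue_measurable_null A : lambda A = 0%E -> lebesgue_measurable A.
Proof.
move=> A0; apply: le_caratheodory_measurable => X.
have XA : lambda (X `&` A) = 0%E by apply: lambda_nullS A0; exact: subIsetr.
by rewrite /= XA add0e; apply: le_lambda; exact: subIsetl.
Qed.

Lemma lebesgue_measurable_bigcup (J : countType) (F : J -> set (I -> R)) :
  (forall j, lebesgue_measurable (F j)) -> lebesgue_measurable (\bigcup_j F j).
Proof.
move=> mF; rewrite bigcup_unpickle; apply: caratheodory_measurable_bigcup => n.
by case: (unpickle n) => [j|]; [exact: mF|exact: caratheodory_measurable_set0].
Qed.

(** Cutting each box of a cover along the hyperplane yields two half-open boxes, possibly empty,
    with no more total volume. One family covers the part of [X] in the half-space, the other the
    rest. *)
Lemma lebesgue_measurable_halfspace_le i (c : R) :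
  lebesgue_measurable [set x : I -> R | x i <= c].
Proof.
apply: le_caratheodory_measurable => X.
apply/ereal_infP => _ [D [a [b [XD ->]]]].
pose b' k := upd (b k) i (Num.min (b k i) c).
pose a' k := upd (a k) i (Num.max (a k i) c).
apply: (@le_trans _ _ (\esum_(k in D) (box_volume (a k) (b' k))%:E +
                       \esum_(k in D) (box_volume (a' k) (b k))%:E)%E).
  apply: leeD; apply: lambda_cover => x [/XD[k Dk bk] /= xc]; exists k => // j.
    rewrite /b' /upd; case: eqP => [->|_]; last exact: bk.
    by have /andP[-> h] := bk i; rewrite le_min h.
  rewrite /a' /upd; case: eqP => [->|_]; last exact: bk.
  have /andP[h ->] := bk i; rewrite gt_max h andbT/= ltNge.
  exact/negP.
rewrite -esumD; try by move=> k _; rewrite lee_fin box_volume_ge0.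
apply: le_esum => k _; rewrite -EFinD lee_fin /box_volume.
rewrite [X in X + _](bigD1 i)//= [X in _ + X](bigD1 i)//= [leRHS](bigD1 i)//=.
rewrite /a' /b' /upd eqxx.
rewrite (eq_bigr (fun j => Num.max 0 (b k j - a k j))); last by move=> j /negbTE ->.
rewrite [X in _ + _ * X](eq_bigr (fun j => Num.max 0 (b k j - a k j))); last first.
  by move=> j /negbTE ->.
rewrite -mulrDl ler_wpM2r//.
  by apply: prodr_ge0 => j _; rewrite le_max lexx.
have [bc|cb] := leP (b k i) c.
  rewrite [X in _ + X]max_l ?addr0// subr_le0.
  by rewrite (le_trans bc)// le_max lexx orbT.
have [ca|ac] := leP c (a k i).
  rewrite [X in X + _]max_l ?add0r// subr_le0 //.
rewrite !max_r ?subr_ge0 ?(ltW ac) ?(ltW cb) ?(ltW (lt_trans ac cb))//.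
by rewrite addrC subrKA.
Qed.

Lemma lebesgue_measurable_halfspace_lt i (c : R) :
  lebesgue_measurable [set x : I -> R | x i < c].
Proof.
rewrite (_ : mkset _ = \bigcup_n [set x : I -> R | x i <= c - n.+1%:R^-1]).
  by apply: lebesgue_measurable_bigcup => n; exact: lebesgue_measurable_halfspace_le.
apply/seteqP; split => [x /= xc|x [n _ /=]]; last first.
  by move/le_lt_trans; apply; rewrite ltrBlDr ltrDl invr_gt0.
have xc0 : 0 < c - x i by rewrite subr_gt0.
have [n _ h] := near_infty_natSinv_lt (PosNum xc0).
by exists n => //=; rewrite lerBrDr addrC -lerBrDr ltW//; exact: (h n (leqnn n)).
Qed.

Lemma lebesgue_measurable_halfspace_ge i (c : R) :
  lebesgue_measurable [set x : I -> R | c <= x i].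
Proof.
rewrite (_ : mkset _ = ~` [set x : I -> R | x i < c]).
  exact/caratheodory_measurable_setC/lebesgue_measurable_halfspace_lt.
by apply/seteqP; split => x /=; rewrite leNgt; move/negP.
Qed.

Lemma lebesgue_measurable_halfspace_gt i (c : R) :
  lebesgue_measurable [set x : I -> R | c < x i].
Proof.
rewrite (_ : mkset _ = ~` [set x : I -> R | x i <= c]).
  exact/caratheodory_measurable_setC/lebesgue_measurable_halfspace_le.
by apply/seteqP; split => x /=; rewrite ltNge; move/negP.
Qed.

Lemma lebesgue_measurable_forall (F : I -> set (I -> R)) :
  (forall i, lebesgue_measurable (F i)) ->
  lebesgue_measurable [set x | forall i, F i x].
Proof.
move=> mF; rewrite (_ : mkset _ = ~` \bigcup_i ~` F i).
  apply: caratheodory_measurable_setC; apply: lebesgue_measurable_bigcup => i.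
  by apply: caratheodory_measurable_setC; exact: mF.
apply/seteqP; split => x /=; first by move=> h [i _]; apply; exact: h.
by move=> h i; apply: contrapT => nF; apply: h; exists i.
Qed.

Lemma lebesgue_measurable_linf_ball x (r : R) :
  lebesgue_measurable (linf_ball x r).
Proof.
apply: (@lebesgue_measurable_forall (fun i => [set y | `|x i - y i| < r])) => i.
rewrite (_ : mkset _ = [set y | x i - r < y i] `&` [set y | y i < x i + r]).
  apply: caratheodory_measurable_setI; first exact: lebesgue_measurable_halfspace_gt.
  exact: lebesgue_measurable_halfspace_lt.
by apply/seteqP; split => y /=; rewrite ltr_distlC => /andP.
Qed.

Lemma lebesgue_measurable_unit_cube : lebesgue_measurable (@unit_cube R I).
Proof.
apply: (@lebesgue_measurable_forall (fun i => [set y | 0 <= y i <= 1])) => i.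
rewrite (_ : mkset _ = [set y | 0 <= y i] `&` [set y | y i <= 1]).
  apply: caratheodory_measurable_setI; first exact: lebesgue_measurable_halfspace_ge.
  exact: lebesgue_measurable_halfspace_le.
by apply/seteqP; split => y /= => /andP.
Qed.

Lemma lambda_linf_ball x (r : R) : 0 < r ->
  lambda (linf_ball x r) = ((2 * r) ^+ #|I|)%:E.
Proof.
move=> r0; rewrite /linf_ball.
rewrite (@lambda_prod R I (fun i => [set y | `|x i - y| < r])
  (fun i => x i - r) (fun i => x i + r)).
- congr (_%:E); rewrite (eq_bigr (fun=> 2 * r)) ?prodr_const// => i _.
  by rewrite opprB addrCA [X in _ + X]addrAC subrr add0r mulr_natl mulr2n.
- by move=> i; rewrite ltrD2l (lt_trans _ r0)// oppr_lt0.
- by move=> i y /=; rewrite in_itv/= ltr_distlC.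
- by move=> i y /=; rewrite in_itv/= ltr_distlC => /andP[/ltW -> /ltW ->].
Qed.

Lemma lambda_unit_cube : lambda (@unit_cube R I) = 1%E.
Proof.
rewrite /unit_cube (@lambda_prod R I (fun i => [set y | 0 <= y <= 1]) (cst 0) (cst 1)).
- by rewrite big1// => i _; rewrite subr0.
- by move=> i; exact: ltr01.
- by move=> i y /=; rewrite in_itv/= => /andP[/ltW -> /ltW ->].
- by move=> i y /=; rewrite in_itv.
Qed.

Lemma lambda_cube_fin A : A `<=` unit_cube -> lambda A \is a fin_num.
Proof.
move=> AU; rewrite ge0_fin_numE ?lambda_ge0//.
by apply: le_lt_trans (le_lambda AU) _; rewrite lambda_unit_cube ltry.
Qed.

(** The hyperplane is exhausted by its traces on the balls around the constant point [c], and each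
    trace fits in one flat box of arbitrarily small volume. *)
Lemma lambda_hyperplane i (c : R) : lambda [set x : I -> R | x i = c] = 0%E.
Proof.
rewrite (_ : mkset _ = \bigcup_n ([set x : I -> R | x i = c] `&`
  linf_ball (fun=> c) n.+1%:R)); last first.
  apply/seteqP; split => [x /= xc|x [n _ []//]].
  pose M := \sum_j `|c - x j|; exists (Num.truncn M) => //; split => // j.
  apply: le_lt_trans (truncnS_gt _).
  by rewrite /M (bigD1 j)//= lerDl sumr_ge0.
apply: lambda_null_bigcup => n; apply/eqP; rewrite eq_le lambda_ge0 andbT.
apply/lee_addgt0Pr => e e0; rewrite add0e.
(* [M] is the product of the sides other than the [i]-th, so thickness [e / M] gives volume [e]. *)
pose M : R := (2 * n.+1%:R) ^+ #|I|.-1.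
have M0 : 0 < M by rewrite exprn_gt0.
have h0 : 0 < e / M by rewrite divr_gt0.
pose a := upd (fun=> c - n.+1%:R) i (c - e / M).
pose b := upd (fun=> c + n.+1%:R) i c.
apply: (@le_trans _ _ (\esum_(k in [set tt]) (box_volume a b)%:E)%E).
  apply: (@lambda_cover unit [set tt] (fun=> a) (fun=> b)) => x [/= xc xb].
  exists tt => // j; rewrite /a /b /upd; case: eqP => [->|_].
    by rewrite xc lexx andbT ltrBlDr ltrDl.
  by have := xb j; rewrite ltr_distlC => /andP[-> /ltW ->].
rewrite esum_set1 ?lee_fin ?box_volume_ge0// /box_volume (bigD1 i)//=.
rewrite (eq_bigr (fun=> 2 * n.+1%:R)).
  rewrite prodr_const /a /b /upd eqxx opprB addrC subrK max_r ?(ltW h0)//.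
  by rewrite cardC1 -/M divfK// gt_eqF.
move=> j ji; rewrite /a /b /upd (negbTE ji) opprB addrCA [X in _ + X]addrAC subrr add0r.
by rewrite mulr_natl mulr2n max_r// addr_ge0.
Qed.

End lambda_outer_measure.

(** * Sets of vanishing relative density *)

Section thin.
Variables (R : realType) (I : finType).
Implicit Types (x : I -> R) (A B : set (I -> R)) (r e : R).

(** Relative density 0 at [x] within the cube, in multiplied form and for the outer measure, so that
    it applies to any [A]. The sets thin at a given point form an ideal ([thinS], [thinU]). *)
Definition thin A x := forall e, 0 < e -> exists2 d, 0 < d & forall r, 0 < r < d ->
  (lambda (linf_ball x r `&` unit_cube `&` A)
    <= e%:E * lambda (linf_ball x r `&` unit_cube))%E.

(** A side of a ball truncated by the cube. Whether it contains its ends depends on which of them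
    come from the cube, hence the product lemmas accept any set between an open interval and its
    closure. *)
Definition cube_side x r : I -> set R := fun i => [set t | `|x i - t| < r /\ 0 <= t <= 1].

Definition side_left x r i : R := Num.max 0 (x i - r).

Definition side_right x r i : R := Num.min 1 (x i + r).

Lemma linf_ball_cubeE x r :
  linf_ball x r `&` unit_cube = [set y | forall i, cube_side x r i (y i)].
Proof.
apply/seteqP; split => [y [h h'] i|y h]; first by split; [exact: h|exact: h'].
by split => i; case: (h i).
Qed.

Lemma side_lt x r i : unit_cube x -> 0 < r -> side_left x r i < side_right x r i.
Proof.
move=> /(_ i)/andP[x0 x1] r0; rewrite /side_left /side_right gt_max !lt_min ltr01/=.
rewrite (ltr_wpDl x0 r0) ltrBlDr (le_lt_trans x1) ?ltrDl//=.
by rewrite (lt_trans (y := x i))// ?ltrBlDr ltrDl.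
Qed.

Lemma side_open x r i : `]side_left x r i, side_right x r i[ `<=` cube_side x r i.
Proof.
move=> t /=; rewrite in_itv/= /side_left /side_right gt_max lt_min.
move=> /andP[/andP[t0 t1] /andP[t2 t3]].
by split; [rewrite ltr_distlC t1 t3|rewrite (ltW t0) (ltW t2)].
Qed.

Lemma side_closed x r i : cube_side x r i `<=` `[side_left x r i, side_right x r i].
Proof.
move=> t /= [+ /andP[t0 t1]]; rewrite ltr_distlC => /andP[h1 h2].
by rewrite in_itv/= /side_left /side_right ge_max le_min t0 t1 (ltW h1) (ltW h2).
Qed.

Lemma lambda_ball_cube x r : unit_cube x -> 0 < r ->
  exists2 v, 0 < v & lambda (linf_ball x r `&` unit_cube) = v%:E.
Proof.
move=> xU r0; rewrite linf_ball_cubeE.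
exists (\prod_i (side_right x r i - side_left x r i)).
  by apply: prodr_gt0 => i _; rewrite subr_gt0 side_lt.
apply: (@lambda_prod R I (cube_side x r)) => i.
- exact: side_lt.
- exact: side_open.
- exact: side_closed.
Qed.

Lemma thinS A B x : unit_cube `&` A `<=` B -> thin B x -> thin A x.
Proof.
move=> AB tB e e0; have [d d0 h] := tB e e0; exists d => // r rd.
apply: le_trans (h r rd); apply: le_lambda => y [[yb yU] Ay].
by split => //; exact: AB.
Qed.

Lemma thin_null A x : lambda (unit_cube `&` A) = 0%E -> thin A x.
Proof.
move=> A0 e e0; exists 1 => // r _.
rewrite (lambda_nullS _ A0); last by move=> y [[_ yU] Ay].
by rewrite mule_ge0 ?lambda_ge0// lee_fin ltW.
Qed.

Lemma thinU A B x : thin A x -> thin B x -> thin (A `|` B) x.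
Proof.
move=> tA tB e e0; have e20 : 0 < e / 2 by rewrite divr_gt0.
have [d d0 hA] := tA _ e20; have [d' d'0 hB] := tB _ e20.
exists (Num.min d d'); first by rewrite lt_min d0.
move=> r; rewrite lt_min => /andP[r0 /andP[rd rd']].
rewrite setIUr; apply: le_trans (outer_measureU2 _ _ _) _ => /=.
apply: le_trans (leeD (hA r _) (hB r _)) _; rewrite ?r0//.
by rewrite -ge0_muleDl ?lee_fin ?(ltW e20)// -EFinD -splitr.
Qed.

(** The list will be a clause. Its literals contain functions and have no [eqType] structure, hence
    [List.In]. *)
Lemma thin_bigcup_list (X : Type) (s : seq X) (F : X -> set (I -> R)) x :
  (forall l, List.In l s -> thin (F l) x) ->
  thin [set y | exists2 l, List.In l s & F l y] x.
Proof.
elim: s => [_|l s ih h].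
  apply: thin_null; rewrite (_ : _ `&` _ = set0) ?lambda0//.
  by apply/seteqP; split => // y [_ [l []]].
apply: (@thinS _ (F l `|` [set y | exists2 l, List.In l s & F l y])).
  by move=> y [_ [k /= [<-|ks] Fk]]; [left|right; exists k].
by apply: thinU; [apply: h; left|apply: ih => k ks; apply: h; right].
Qed.

Lemma not_thin_cube x : unit_cube x -> ~ thin setT x.
Proof.
move=> xU /(_ (2^-1)) [|d d0 h]; first by rewrite invr_gt0.
have d20 : 0 < d / 2 by rewrite divr_gt0.
have dd : d / 2 < d by rewrite ltr_pdivrMr// mulr_natr mulr2n ltrDl.
have := h (d / 2); rewrite d20 dd => /(_ isT).
have [v v0 E] := lambda_ball_cube xU d20.
rewrite setIT E -EFinM lee_fin -[leLHS]mul1r ler_pM2r//.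
by rewrite leNgt invf_lt1// ltr1n.
Qed.

(** The Carathéodory condition for [A], tested on the truncated ball, turns the share of [A] into 1
    minus the share of its complement. Density 1 of [A] thereby becomes thinness of the
    complement. *)
Lemma density_ratio A x r : A `<=` unit_cube -> lebesgue_measurable A ->
  unit_cube x -> 0 < r -> exists v p,
  [/\ 0 < v, lambda (linf_ball x r `&` unit_cube) = v%:E, 0 <= p,
      lambda (linf_ball x r `&` unit_cube `&` ~` A) = p%:E &
      (lambda (linf_ball x r `&` A) / lambda (linf_ball x r `&` unit_cube))%E
        = (1 - p / v)%:E].
Proof.
move=> AU mA xU r0; have [v v0 Ev] := lambda_ball_cube xU r0.
have := mA (linf_ball x r `&` unit_cube); rewrite Ev.
rewrite -setIA (setIidr AU).
have Bfin : lambda (linf_ball x r `&` unit_cube `&` ~` A) \is a fin_num.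
  by apply: lambda_cube_fin => y [[]].
have Afin : lambda (linf_ball x r `&` A) \is a fin_num.
  by apply: lambda_cube_fin => y [_ /AU].
rewrite -(fineK Bfin) -(fineK Afin).
set p := fine (lambda (_ `&` ~` A)); set q := fine _.
rewrite -EFinD => -[E]; exists v, p; split => //.
  by rewrite fine_ge0// lambda_ge0.
rewrite inver gt_eqF// -EFinM; congr (_%:E).
have -> : q = v - p by rewrite E addrK.
by rewrite mulrBl divff// gt_eqF.
Qed.

Lemma density_pointsP A x : A `<=` unit_cube -> lebesgue_measurable A ->
  density_points A x <-> unit_cube x /\ thin (~` A) x.
Proof.
move=> AU mA; rewrite /density_points /=.
split=> -[xU h]; split => //.
  have {h} /fine_cvgP[_ /cvgrPdist_le h] := h.
  move=> e e0; have /nbhs_ballP[d /= d0 hd] := h e e0.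
  exists d => // r /andP[r0 rd].
  have [v [p [v0 Ev p0 Ep Er]]] := density_ratio AU mA xU r0.
  have := hd r; rewrite /ball/= sub0r normrN gtr0_norm// => /(_ rd r0).
  rewrite /= Er /= opprB addrC subrK ger0_norm ?divr_ge0 ?(ltW v0)//.
  by rewrite ler_pdivrMr// Ev Ep -EFinM lee_fin.
apply/fine_cvgP; split.
  near=> r; have r0 : 0 < r by [].
  by have [v [p [v0 Ev p0 Ep ->]]] := density_ratio AU mA xU r0.
apply/cvgrPdist_le => e e0; have [d d0 hd] := h e e0.
near=> r; have r0 : 0 < r by []. have rd : r < d by near: r; exact: nbhs_right_lt.
have [v [p [v0 Ev p0 Ep /= Er]]] := density_ratio AU mA xU r0.
rewrite /= Er /= opprB addrC subrK ger0_norm ?divr_ge0 ?(ltW v0)//.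
have := hd r; rewrite r0 rd => /(_ isT).
by rewrite Ev Ep -EFinM lee_fin ler_pdivrMr.
Unshelve. all: by end_near. Qed.

End thin.

(** A truncated ball over [I] projects onto the truncated ball of the same radius over [J], so
    [lambda_preimage_prod] makes the two inequalities equivalent radius by radius. *)
Lemma thin_preimage (R : realType) (I J : finType) (f : J -> I) (x : I -> R)
    (A : set (J -> R)) : injective f -> unit_cube x ->
  thin A (x \o f) <-> thin ((fun y : I -> R => y \o f) @^-1` A) x.
Proof.
move=> finj xU; have xfU : unit_cube (x \o f) by move=> j; exact: xU.
have key r e : 0 < r ->
  (lambda (linf_ball (x \o f) r `&` unit_cube `&` A)
    <= e%:E * lambda (linf_ball (x \o f) r `&` unit_cube))%E =
  (lambda (linf_ball x r `&` unit_cube `&` (fun y : I -> R => y \o f) @^-1` A)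
    <= e%:E * lambda (linf_ball x r `&` unit_cube))%E.
  move=> r0.
  have Jfin : lambda (linf_ball (x \o f) r `&` unit_cube `&` A) \is a fin_num.
    by apply: lambda_cube_fin => y [[]].
  have Ifin : lambda (linf_ball x r `&` unit_cube `&`
      (fun y : I -> R => y \o f) @^-1` A) \is a fin_num.
    by apply: lambda_cube_fin => y [[]].
  have [v v0 Ev] := lambda_ball_cube xU r0.
  have [w w0 Ew] := lambda_ball_cube xfU r0.
  have := @lambda_preimage_prod R I J f (linf_ball (x \o f) r `&` unit_cube `&` A)
    (cube_side x r) (side_left x r) (side_right x r) finj
    (fun i => side_lt i xU r0) (@side_open _ _ x r) (@side_closed _ _ x r) _ Jfin.
  rewrite -linf_ball_cubeE Ev.
  rewrite (_ : [set y | _] = linf_ball (x \o f) r `&` unit_cube); last first.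
    by rewrite linf_ball_cubeE.
  rewrite Ew (_ : _ `&` (linf_ball x r `&` unit_cube) = linf_ball x r `&` unit_cube `&`
      (fun y : I -> R => y \o f) @^-1` A); last first.
    apply/seteqP; split => [y [[_ Ay] yb]|y [[yb yU] Ay]]; split => //.
    by split => //; split => j /=; [exact: yb|exact: yU].
  rewrite -(fineK Jfin) -(fineK Ifin); set p := fine _; set q := fine _.
  move=> /(_ (@subIsetl _ _ _)); rewrite -!EFinM => -[E].
  (* Scaled by [v] and by [w] respectively, the two inequalities coincide in view of [E]. *)
  by rewrite !lee_fin -(ler_pM2r v0 _ (e * w)) -E -[RHS](ler_pM2r w0) mulrAC.
split => h e e0; have [d d0 hd] := h e e0; exists d => // r /andP[r0 rd].
  by rewrite -key// hd// r0.
by rewrite key// hd// r0.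
Qed.

Lemma lambda_preimage_null (R : realType) (I J : finType) (f : J -> I)
    (A : set (J -> R)) : injective f -> lambda (unit_cube `&` A) = 0%E ->
  lambda (unit_cube `&` (fun y : I -> R => y \o f) @^-1` A) = 0%E.
Proof.
move=> finj A0.
have Afin : lambda (unit_cube `&` A) \is a fin_num by rewrite A0.
have := @lambda_preimage_prod R I J f (unit_cube `&` A)
  (fun i => [set t | 0 <= t <= 1]) (fun=> 0) (fun=> 1) finj _ _ _ _ Afin.
have E (K : finType) :
  [set y : K -> R | forall j, [set t | 0 <= t <= 1] (y j)] = unit_cube by [].
rewrite !E A0 mul0e !lambda_unit_cube mule1 => h.
apply: lambda_nullS (h _ _ _ _).
- by move=> y [yU Ay]; split => //; split => // j; exact: yU.
- by move=> i; exact: ltr01.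
- by move=> i y /=; rewrite in_itv/= => /andP[/ltW -> /ltW ->].
- by move=> i y /=; rewrite in_itv.
- exact: subIsetl.
Qed.

(** * The density theorem *)

(* Zorn is applied to the disjoint families in which every x that meets the
   family meets a member of at least half its size; such a family can be
   enlarged as long as some x avoids it. *)
Lemma vitali_selection (R : realType) (X : Type) (V : set X)
    (meet : X -> X -> Prop) (rad : X -> R) (M : R) :
  (forall x y, meet x y -> meet y x) -> (forall x, V x -> meet x x) ->
  (forall x, V x -> 0 < rad x <= M) ->
  exists D : set X, [/\ D `<=` V,
    forall x y, D x -> D y -> meet x y -> x = y &
    forall x, V x -> exists2 y, D y & meet x y /\ rad x <= 2 * rad y].
Proof.
move=> meetC meetxx radM.
pose P (D : set X) := [/\ D `<=` V,
  forall x y, D x -> D y -> meet x y -> x = y &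
  forall x y, V x -> D y -> meet x y ->
    exists2 z, D z & meet x z /\ rad x <= 2 * rad z].
have [F FP Ftot|D [[DV Dtriv Dbig] Dmax]] := @Zorn_bigcup X P.
  split.
  - by move=> x [D FD Dx]; have [DV _ _] := FP _ FD; exact: DV.
  - move=> x y [D FD Dx] [D' FD' D'y].
    have [DD'|D'D] := Ftot _ _ FD FD'.
      by have [_ h _] := FP _ FD'; apply: h => //; exact: DD'.
    by have [_ h _] := FP _ FD; apply: h => //; exact: D'D.
  - move=> x y Vx [D FD Dy] xy; have [_ _ h] := FP _ FD.
    by have [z Dz ?] := h _ _ Vx Dy xy; exists z => //; exists D.
exists D; split => // x0 Vx0; apply: contrapT => nx0.
(* By [Dbig], an uncontrolled [x0] cannot meet any member of [D], so [W] is non-empty. Adding to [D]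
   an element of [W] whose size exceeds half the supremum over [W] will contradict maximality. *)
pose W : set X := [set x | V x /\ forall y, D y -> ~ meet x y].
have Wx0 : W x0.
  by split => // y Dy xy; apply: nx0; exact: Dbig Dy xy.
have [x1 [Vx1 nx1] x1max] : exists2 x1, W x1 & forall x, W x -> rad x <= 2 * rad x1.
  pose S := rad @` W.
  have S0 : has_sup S.
    split; first by exists (rad x0); exists x0.
    by exists M => _ [x [/radM/andP[_ xM] _] <-].
  have s0 : 0 < sup S.
    have /radM/andP[r0 _] := Vx0.
    by apply: (lt_le_trans r0); apply: sup_upper_bound => //; exists x0.
  have s20 : 0 < sup S / 2 by rewrite divr_gt0.
  have [_ [x1 Wx1 <-] h] := sup_adherent s20 S0; exists x1 => // x Wx.
  apply: (@le_trans _ _ (sup S)); first by apply: sup_upper_bound => //; exists x.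
  rewrite mulrC -ler_pdivrMr// ltW//; apply: le_lt_trans h.
  by rewrite {2}(splitr (sup S)) addrK.
apply: (Dmax (D `|` [set x1])).
  split; first exact: subsetUl.
  by move=> /(_ x1 (or_intror erefl)) Dx1; apply: (nx1 x1) => //; exact: meetxx.
split.
- by move=> x [/DV//|->].
- move=> x y [Dx|->] [Dy|->]//; first exact: Dtriv.
    by move=> /meetC xy; case: (nx1 x Dx xy).
  by move=> xy; case: (nx1 y Dy xy).
(* Either [x] already meets the old family, or it lies in [W] and [x1] is large enough for it. *)
- move=> x y Vx Dy xy; have [[z Dz xz]|nz] := pselect (exists2 z, D z & meet x z).
    by have [t Dt ?] := Dbig _ _ Vx Dz xz; exists t => //; left.
  have Wx : W x by split => // z Dz xz; apply: nz; exists z.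
  case: Dy => [Dy|yx1]; first by case: nz; exists y.
  by exists x1; [right|rewrite -yx1; split => //; rewrite yx1; exact: x1max].
Qed.

Section density_theorem.
Variables (R : realType) (I : finType).
Implicit Types (x y : I -> R) (A : set (I -> R)).

(** Each ball contains a point with rational coordinates, and disjointness makes the choice of that
    point injective. *)
Lemma countable_disjoint_balls (D : set (I -> R)) (rad : (I -> R) -> R) :
  (forall x, D x -> 0 < rad x) ->
  (forall x y, D x -> D y ->
    linf_ball x (rad x) `&` linf_ball y (rad y) !=set0 -> x = y) ->
  countable D.
Proof.
move=> rad0 Dtriv.
have /choice[q qP] x : exists q : {ffun I -> rat},
    D x -> linf_ball x (rad x) (fun i => ratr (q i)).
  have [Dx|nDx] := pselect (D x); last by exists [ffun=> 0].
  have /choice[q qP] i : exists q : rat, `|x i - ratr q| < rad x.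
    have [|q] := @rat_in_itvoo R (x i - rad x) (x i + rad x).
      by rewrite ltrD2l (lt_trans _ (rad0 _ Dx))// oppr_lt0 rad0.
    by rewrite in_itv/= -ltr_distlC => h; exists q.
  by exists (finfun q) => _ i; rewrite ffunE.
apply/countable_injP; exists (pickle \o q) => x y; rewrite !inE => Dx Dy /=.
move=> /(pcan_inj pickleK) qxy; apply: Dtriv => //.
by exists (fun i => ratr (q x i)); split; [exact: qP|rewrite qxy; exact: qP].
Qed.

Lemma linf_ball_in_box x (a b : I -> R) : (forall i, a i < x i < b i) ->
  exists2 d, 0 < d & linf_ball x d `<=` [set y | forall i, a i < y i < b i].
Proof.
move=> axb.
have : \forall d \near 0^'+, forall i, d < x i - a i /\ d < b i - x i.
  apply: filter_forall => i; have /andP[ax xb] := axb i.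
  by near=> d; split; near: d; apply: nbhs_right_lt; rewrite subr_gt0.
move=> h; have : \forall d \near 0^'+, 0 < d /\ forall i, d < x i - a i /\ d < b i - x i.
  by near=> d; split; [|near: d].
move=> /filter_ex[d [d0 hd]]; exists d => // y yd i.
have [da db] := hd i; have := yd i; rewrite ltr_distlC => /andP[h1 h2].
by rewrite (lt_trans _ h1) ?(lt_trans h2)// -?ltrBrDl// ltrBrDr -ltrBrDl.
Unshelve. all: by end_near. Qed.

(** Take a cover of total volume below [lambda A + e]. Measurability of [A] splits the measure of
    its union, so the excess over [A] is at most [e]. *)
Lemma lambda_outer_cover A (e : R) : lebesgue_measurable A -> lambda A \is a fin_num ->
  0 < e -> exists (D : set nat) (a b : nat -> I -> R),
  let U := \bigcup_(k in D) half_open_box (a k) (b k) in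
  A `<=` U /\ (lambda (U `&` ~` A) <= e%:E)%E.
Proof.
move=> mA Afin e0.
have [s [D [a [b [AD ->]]]] h] := lb_ereal_inf_adherent e0 Afin.
exists D, a, b; split => //; set U := bigcup _ _ in AD *.
have := lambda_cover (@subset_refl _ U); rewrite mA (setIidr AD) => /le_lt_trans/(_ h).
by move/ltW; rewrite leeD2lE.
Qed.

Definition bad_points A (e : R) : set (I -> R) := A `&` [set x | forall d, 0 < d ->
  exists2 r, 0 < r < d & (e%:E * lambda (linf_ball x r `&` unit_cube)
    < lambda (linf_ball x r `&` unit_cube `&` ~` A))%E].

(** Select disjoint balls whose threefold enlargements contain [E]. Enlarging multiplies the measure
    by [3 ^+ #|I|], and each selected ball has at least the share [e] of its measure in [U] minus
    [A], where the disjoint pieces add up. *)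
Lemma vitali_cover_bound (E U A : set (I -> R)) (rad : (I -> R) -> R) (e : R) :
  0 < e -> lebesgue_measurable A ->
  (forall x, E x -> [/\ 0 < rad x <= 1, linf_ball x (rad x) `<=` U &
    (e%:E * lambda (linf_ball x (rad x)) <= lambda (linf_ball x (rad x) `&` ~` A))%E]) ->
  (lambda E <= (3 ^+ #|I| / e)%:E * lambda (U `&` ~` A))%E.
Proof.
move=> e0 mA hE.
have rad0 x : E x -> 0 < rad x by move=> /hE[/andP[]].
have [||D [DE Dtriv Dcov]] := @vitali_selection R (I -> R) E
   (fun x y => linf_ball x (rad x) `&` linf_ball y (rad y) !=set0) rad 1 _ _
   (fun x Ex => let: And3 h _ _ := hE x Ex in h).
- by move=> x y; rewrite setIC.
- by move=> x Ex; exists x; split => i; rewrite subrr normr0 rad0.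
have /countable_injP[f finj] : countable D.
  by apply: (@countable_disjoint_balls D rad) => // x /DE; exact: rad0.
(* [F] and [G] enumerate the selected balls and their enlargements through the injection [f]; they
   are empty at the indices that [f] does not attain on [D]. *)
pose F n := [set y | exists x, [/\ D x, f x = n & linf_ball x (rad x) y]].
pose G n := [set y | exists x, [/\ D x, f x = n & linf_ball x (3 * rad x) y]].
have FG n : F n = set0 /\ G n = set0 \/ exists x,
    [/\ D x, F n = linf_ball x (rad x) & G n = linf_ball x (3 * rad x)].
  have [[x [Dx fx]]|nx] := pselect (exists x, D x /\ f x = n); [right|left].
    have ux z : D z -> f z = n -> z = x.
      by move=> Dz fz; apply: finj; rewrite ?inE// fz fx.
    exists x; split => //; apply/seteqP; split => y.
    - by move=> [z [Dz fz]]; rewrite (ux z).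
    - by move=> xy; exists x.
    - by move=> [z [Dz fz]]; rewrite (ux z).
    - by move=> xy; exists x.
  by split; apply/seteqP; split => // y [x [Dx fx _]]; apply: nx; exists x.
have mF n : lebesgue_measurable (F n).
  have [[-> _]|[x [_ -> _]]] := FG n; first exact: caratheodory_measurable_set0.
  exact: lebesgue_measurable_linf_ball.
have tF : trivIset setT F.
  move=> m n _ _ [y [[x [Dx <- xy]] [z [Dz <- zy]]]].
  by congr f; apply: Dtriv => //; exists y.
have EG : E `<=` \bigcup_n G n.
  move=> x Ex; have [y Dy [[z [zx zy]] xy]] := Dcov x Ex.
  exists (f y) => //; exists y; split => // i.
  (* Only the centres of the balls must be covered, and [rad x <= 2 * rad y] gives
     [rad y + rad x <= 3 * rad y]. *)
  apply: (@lt_le_trans _ _ (rad y + rad x)).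
    rewrite -(subrKA (z i)); apply: le_lt_trans (ler_normD _ _) _.
    by apply: ltrD; [exact: zy|rewrite distrC; exact: zx].
  by rewrite -(nat1r 2) mulrDl mul1r lerD2l.
apply: le_trans (le_lambda EG) _; apply: le_trans (lambda_sigma_subadditive _) _.
have c0 : 0 <= 3 ^+ #|I| / e :> R by rewrite divr_ge0 ?exprn_ge0// ltW.
have step n : (lambda (G n) <= (3 ^+ #|I| / e)%:E * lambda (U `&` ~` A `&` F n))%E.
  have [[_ ->]|[x [Dx -> ->]]] := FG n.
    by rewrite lambda0 mule_ge0 ?lambda_ge0.
  have [/andP[r0 _] xU hx] := hE _ (DE _ Dx).
  rewrite (_ : _ `&` _ = linf_ball x (rad x) `&` ~` A); last first.
    by apply/seteqP; split => y [] => [[_ nA] xy|xy nA]; split => //; split => //; exact: xU.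
  rewrite lambda_linf_ball ?mulr_gt0// mulrCA [(3 * _) ^+ _]exprMn EFinM.
  rewrite [X in (_ <= X * _)%E]EFinM -muleA lee_pmul2l ?lte_fin ?exprn_gt0//.
  by rewrite lee_pdivlMl// -(lambda_linf_ball x).
apply: (@le_trans _ _ (\sum_(n <oo) (3 ^+ #|I| / e)%:E * lambda (U `&` ~` A `&` F n))%E).
  by apply: lee_nneseries => // n _ _; exact: lambda_ge0.
rewrite nneseriesZl; last by move=> n _; exact: lambda_ge0.
apply: lee_wpmul2l; first by rewrite lee_fin.
(* Additivity over the disjoint measurable [F n], relative to a test set. *)
apply: le_trans (caratheodory_lime_le mF tF (U `&` ~` A)).
by rewrite leeDl// lambda_ge0.
Qed.

Lemma bad_points_null A (e : R) : A `<=` unit_cube -> lebesgue_measurable A ->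
  0 < e -> lambda (bad_points A e) = 0%E.
Proof.
move=> AU mA e0; apply/eqP; rewrite eq_le lambda_ge0 andbT.
apply/lee_addgt0Pr => t t0; rewrite add0e.
have C0 : 0 < 3 ^+ #|I| / e :> R by rewrite divr_gt0 ?exprn_gt0.
(* The excess is chosen so that the constant of [vitali_cover_bound] brings it to exactly [t]. *)
have [|D [a [b [AV Veps]]]] :=
  @lambda_outer_cover A (t / (3 ^+ #|I| / e)) mA (lambda_cube_fin AU).
  by rewrite divr_gt0.
set U := bigcup _ _ in AV Veps.
(* Off the faces of the cube and the upper faces of the covering boxes, small balls around a point
   of [A] stay inside the cube and inside one covering box. The lower faces are already excluded
   from half-open boxes. *)
pose Z := (\bigcup_i [set x : I -> R | x i = 0]) `|` (\bigcup_i [set x | x i = 1])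
  `|` (\bigcup_(ki : nat * I) [set x | x ki.2 = b ki.1 ki.2]).
have Z0 : lambda Z = 0%E.
  do 2?[apply: lambda_nullU];
    apply: lambda_null_bigcup => i; exact: lambda_hyperplane.
apply: (@le_trans _ _ (lambda ((bad_points A e `\` Z) `|` Z))).
  by apply: le_lambda => x bx; have [Zx|nZx] := pselect (Z x); [right|left].
apply: le_trans (outer_measureU2 _ _ _) _; rewrite /= Z0 adde0.
have /choice[rad radP] x : exists r, (bad_points A e `\` Z) x ->
    [/\ 0 < r <= 1, linf_ball x r `<=` U &
      (e%:E * lambda (linf_ball x r) <= lambda (linf_ball x r `&` ~` A))%E].
  have [[[Ax badx] nZ]|nbad] := pselect ((bad_points A e `\` Z) x); last by exists 0.
  have [k Dk xk] := AV x Ax.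
  have [|d d0 hd] := @linf_ball_in_box x (a k) (b k).
    move=> i; have /andP[-> xb] := xk i; rewrite lt_neqAle xb andbT.
    by apply/eqP => xE; apply: nZ; right; exists (k, i).
  have [|d' d'0 hd'] := @linf_ball_in_box x (fun=> 0) (fun=> 1).
    move=> i; have /andP[x0 x1] := AU _ Ax i; rewrite !lt_neqAle x0 x1 !andbT.
    apply/andP; split; apply/eqP => xE; apply: nZ; left.
      by left; exists i.
    by right; exists i.
  (* The bound 1 serves the Vitali selection, [d] keeps the ball in [U], and [d'] keeps it in the
     cube, so that truncation changes nothing. *)
  have [|r] := badx (Num.min 1 (Num.min d d')); first by rewrite !lt_min ltr01 d0.
  rewrite !lt_min => /andP[r0 /andP[r1 /andP[rd rd']]] h; exists r => _.
  have sub s : r < s -> linf_ball x r `<=` linf_ball x s.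
    by move=> rs y yr i; exact: lt_trans (yr i) rs.
  have rU : linf_ball x r `<=` unit_cube.
    by move=> y /(sub _ rd')/hd' h' i; have /andP[/ltW -> /ltW ->] := h' i.
  split; first by rewrite r0 ltW.
  - move=> y /(sub _ rd)/hd h'; exists k => // i.
    by have /andP[-> /ltW ->] := h' i.
  - by move: h; rewrite (setIidl rU) => /ltW.
apply: le_trans (vitali_cover_bound e0 mA radP) _.
apply: le_trans (lee_wpmul2l _ Veps) _; first by rewrite lee_fin ltW.
by rewrite -EFinM mulrC divfK// gt_eqF.
Qed.

Theorem lebesgue_density_cube A : A `<=` unit_cube -> lebesgue_measurable A ->
  lambda (A `&` [set x | ~ thin (~` A) x]) = 0%E.
Proof.
move=> AU mA.
apply: (@lambda_nullS _ _ _ (\bigcup_n bad_points A n.+1%:R^-1)); last first.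
  by apply: lambda_null_bigcup => n; exact: bad_points_null.
move=> x [Ax /= nt]; apply: contrapT => nbad; apply: nt => e e0.
have [n _ hn] := near_infty_natSinv_lt (PosNum e0).
have {}hn : n.+1%:R^-1 <= e by apply: ltW; exact: (hn n (leqnn n)).
apply: contrapT => nd; apply: nbad; exists n => //; split => // d d0.
apply: contrapT => nr; apply: nd; exists d => // r rd.
apply: (@le_trans _ _ (n.+1%:R^-1%:E * lambda (linf_ball x r `&` unit_cube))%E).
  by rewrite leNgt; apply/negP => h; apply: nr; exists r.
by apply: lee_wpmul2r; rewrite ?lambda_ge0// lee_fin.
Qed.

(** The density theorem is applied to [A] and to [B], its complement in the cube. At a density point
    of [A] lying in [B], the complement of [B] cannot be thin as well, since the two complements
    cover the space. *)
Lemma density_points_symdiff A : A `<=` unit_cube -> lebesgue_measurable A ->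
  lambda (A `+` density_points A) = 0%E.
Proof.
move=> AU mA; pose B := unit_cube `\` A.
have BU : B `<=` unit_cube by move=> x [].
have mB : lebesgue_measurable B.
  apply: caratheodory_measurable_setD => //; exact: lebesgue_measurable_unit_cube.
apply: lambda_nullS (lambda_nullU (lebesgue_density_cube AU mA)
                                  (lebesgue_density_cube BU mB)).
move=> x [[Ax nD]|[Dx nA]].
  by left; split => // t; apply: nD; apply/density_pointsP => //; split => //; exact: AU.
move/density_pointsP : Dx => /(_ AU mA) [xU t]; right; split => // t'.
apply: (not_thin_cube xU); apply: thinS (thinU t t') => y [yU _].
by have [Ay|nAy] := pselect (A y); [right=> -[]|left].
Qed.

Lemma lebesgue_measurable_density_points A : A `<=` unit_cube ->
  lebesgue_measurable A -> lebesgue_measurable (density_points A).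
Proof.
move=> AU mA; have N0 := density_points_symdiff AU mA.
rewrite (_ : density_points A = (A `\` (A `\` density_points A))
  `|` (density_points A `\` A)).
  apply: caratheodory_measurable_setU; last first.
    by apply: lebesgue_measurable_null; apply: lambda_nullS N0; exact: subsetUr.
  apply: caratheodory_measurable_setD => //.
  by apply: lebesgue_measurable_null; apply: lambda_nullS N0; exact: subsetUl.
apply/seteqP; split => x.
  by move=> Dx; have [Ax|nA] := pselect (A x); [left; split => // -[]|right].
by move=> [[Ax h]|[]//]; apply: contrapT => nD; apply: h.
Qed.

End density_theorem.

(** * Borel measurability *)

Section density_points_borel.
Variables (R : realType) (I : finType).
Implicit Types (x y : I -> R) (A O : set (I -> R)).

(** As [I] is finite, sup-norm balls are neighbourhoods for the product topology that generates
    [borel_set]. *)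
Lemma ptws_open_linf_ball O :
  (forall x, O x -> exists2 h, 0 < h & linf_ball x h `<=` O) ->
  open (O : set {ptws I -> R}).
Proof.
move=> hO; rewrite openE => x /hO[h h0 xO].
have near_x : \forall y \near (x : {ptws I -> R}), forall i, `|x i - y i| < h.
  apply: (@filter_forall {ptws I -> R} I (fun i y => `|x i - y i| < h) _
    (nbhs_filter (x : {ptws I -> R}))) => i.
  have xh : nbhs (x i) [set t | `|x i - t| < h] by apply/nbhs_ballP; exists h.
  exact: (@proj_continuous I (fun=> R) i x _ xh).
exact: (@filterS _ _ (nbhs_filter (x : {ptws I -> R})) _ _ xO near_x).
Qed.

(** For positive [r] and [h], the measure of the shell between concentric balls of radii [r] and
    [r + h]. *)
Definition annulus_volume (r h : R) := (2 * (r + h)) ^+ #|I| - (2 * r) ^+ #|I|.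

Lemma annulus_volume_small (r e : R) : 0 < e ->
  exists2 h, 0 < h & annulus_volume r h < e.
Proof.
move=> e0.
have h : annulus_volume r h @[h --> 0^'+] --> 0.
  rewrite -[X in _ --> X](subrr ((2 * r) ^+ #|I|)).
  apply: cvgB; last exact: cvg_cst.
  have -> : (2 * r) ^+ #|I| = (2 * (r + 0)) ^+ #|I| by rewrite addr0.
  have lim1 : 2 * (r + h) @[h --> (0 : R)^'+] --> 2 * (r + 0).
    apply: cvgM; first exact: cvg_cst.
    by apply: cvgD; [exact: cvg_cst|exact: cvg_at_right_filter].
  exact: (cvg_comp _ (fun t : R => t ^+ #|I|) lim1 (@exprn_continuous _ _ _)).
move/cvgrPdist_lt : h => /(_ e e0) h.
have : \forall t \near 0^'+, 0 < t /\ `|0 - annulus_volume r t| < e.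
  by near=> t; split => //; near: t.
move=> /filter_ex[t [t0 ht]]; exists t => //.
by apply: le_lt_trans ht; rewrite sub0r normrN ler_norm.
Unshelve. all: by end_near. Qed.

(** The ball of radius [r] at [x] lies in that of radius [r + h] at [y], so whatever leaves the
    [r]-ball at [y] is in the shell. Used in both directions, this is continuity in the centre. *)
Lemma lambda_ball_shift A x y (r h : R) : 0 < r -> 0 < h -> linf_ball x h y ->
  (lambda (linf_ball x r `&` A) <=
   lambda (linf_ball y r `&` A) + (annulus_volume r h)%:E)%E.
Proof.
move=> r0 h0 xy.
have sub : linf_ball x r `&` A `<=`
    (linf_ball y r `&` A) `|` (linf_ball y (r + h) `&` ~` linf_ball y r).
  move=> z [xz Az]; have [yz|nyz] := pselect (linf_ball y r z); [by left|right].
  split => // i; rewrite -(subrKA (x i)) addrC; apply: le_lt_trans (ler_normD _ _) _.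
  by apply: ltrD; [exact: xz|rewrite distrC; exact: xy].
apply: le_trans (le_lambda sub) _; apply: le_trans (outer_measureU2 _ _ _) _ => /=.
apply: leeD2l.
have rh : linf_ball y r `<=` linf_ball y (r + h).
  by move=> z yz i; apply: lt_trans (yz i) _; rewrite ltrDl.
have := lebesgue_measurable_linf_ball y r (linf_ball y (r + h)).
rewrite (setIidr rh) !lambda_linf_ball ?addr_gt0// => E.
have fin : lambda (linf_ball y (r + h) `&` ~` linf_ball y r) \is a fin_num.
  rewrite ge0_fin_numE ?lambda_ge0//; apply: (@le_lt_trans _ _ (lambda (linf_ball y (r + h)))).
    by apply: le_lambda; exact: subIsetl.
  by rewrite lambda_linf_ball ?addr_gt0// ltry.
move: E; rewrite -(fineK fin) -EFinD => -[E].
by rewrite lee_fin /annulus_volume E addrAC subrr add0r.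
Qed.

Lemma open_ball_ratio A (r c : R) : 0 < r -> 0 < c ->
  open ([set x | (c%:E * lambda (linf_ball x r `&` unit_cube)
    < lambda (linf_ball x r `&` unit_cube `&` A))%E] : set {ptws I -> R}).
Proof.
move=> r0 c0; apply: ptws_open_linf_ball => x /=.
have finU (z : I -> R) : lambda (linf_ball z r `&` unit_cube) \is a fin_num.
  by apply: lambda_cube_fin => t [].
have finA z : lambda (linf_ball z r `&` unit_cube `&` A) \is a fin_num.
  by apply: lambda_cube_fin => t [[]].
rewrite -(fineK (finU x)) -(fineK (finA x)) -EFinM lte_fin.
set v := fine (lambda (_ `&` unit_cube)); set g := fine _ => cvg.
(* A shell of measure [m] lets the left side grow by at most [c * m] and the right side drop by at
   most [m]; the margin [g - c * v] must exceed their sum. *)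
have e0 : 0 < (g - c * v) / (1 + c) by rewrite divr_gt0 ?subr_gt0// addr_gt0.
have [h h0 hh] := annulus_volume_small r e0; exists h => // y xy.
have yx : linf_ball y h x by move=> i; rewrite distrC; exact: xy.
have := lambda_ball_shift unit_cube r0 h0 yx.
have := lambda_ball_shift (unit_cube `&` A) r0 h0 xy.
rewrite /= !setIA -(fineK (finU x)) -(fineK (finA x)) -(fineK (finU y)) -(fineK (finA y)).
rewrite -/v -/g -!EFinD -EFinM !lee_fin lte_fin.
set w := fine _; set k := fine _; set m := annulus_volume r h in hh * => gk wv.
move: hh; rewrite ltr_pdivlMr ?addr_gt0// mulrDr mulr1 ltrBrDr => hh.
apply: (@le_lt_trans _ _ (c * (v + m))).
  by rewrite ler_pM2l.
rewrite -(ltrD2r m); apply: lt_le_trans gk; apply: le_lt_trans hh.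
by rewrite mulrDr addrC addrA (mulrC c m) addrAC.
Qed.

Lemma open_not_unit_cube : open (~` unit_cube : set {ptws I -> R}).
Proof.
apply: ptws_open_linf_ball => x /existsNP[i /negP].
rewrite negb_and -!ltNge => /orP[xi|xi].
  exists (- x i); first by rewrite oppr_gt0.
  move=> y /(_ i); rewrite ltr_distlC subrr => /andP[_ yi] /(_ i).
  by rewrite leNgt yi.
exists (x i - 1); first by rewrite subr_gt0.
move=> y /(_ i); rewrite ltr_distlC subKr => /andP[yi _] /(_ i).
by rewrite andbC leNgt yi.
Qed.

Lemma borel_density_points A : A `<=` unit_cube -> lebesgue_measurable A ->
  borel_set (density_points A).
Proof.
move=> AU mA.
(* The complement of [O n m] consists of the cube points where the bound of [thin] at level
   [n.+1%:R^-1] holds for every radius below [m.+1%:R^-1]. The union over real radii is uncountable,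
   but it is a union of open sets. *)
pose O n m : set (I -> R) := ~` unit_cube `|`
  \bigcup_(r in [set r | 0 < r < m.+1%:R^-1])
    [set x | (n.+1%:R^-1%:E * lambda (linf_ball x r `&` unit_cube)
      < lambda (linf_ball x r `&` unit_cube `&` ~` A))%E].
have -> : density_points A = ~` \bigcup_n ~` \bigcup_m ~` O n m.
  apply/seteqP; split => x.
    move=> /(density_pointsP _ AU mA)[xU t] [n _]; apply.
    have [|d d0 hd] := t n.+1%:R^-1; first by rewrite invr_gt0.
    have [m _ hm] := near_infty_natSinv_lt (PosNum d0).
    exists m => // -[/(_ xU)//|[r /= /andP[r0 rm]]].
    rewrite ltNge hd// r0 (lt_trans rm)//; exact: (hm m (leqnn m)).
  move=> h; apply/density_pointsP => //; split.
    apply: contrapT => nx; apply: h; exists 0%N => // -[m _]; apply.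
    by left.
  move=> e e0; apply: contrapT => nd; apply: h.
  have [n _ hn] := near_infty_natSinv_lt (PosNum e0).
  have {}hn : n.+1%:R^-1 <= e by apply: ltW; exact: (hn n (leqnn n)).
  exists n => // -[m _ nO]; apply: nd; exists m.+1%:R^-1; first by rewrite invr_gt0.
  move=> r rm; apply: (@le_trans _ _
      (n.+1%:R^-1%:E * lambda (linf_ball x r `&` unit_cube))%E).
    by rewrite leNgt; apply/negP => hr; apply: nO; right; exists r.
  by apply: lee_wpmul2r; rewrite ?lambda_ge0// lee_fin.
rewrite /borel_set; apply: sigma_algebraC; apply: sigma_algebra_bigcup => n.
apply: sigma_algebraC; apply: sigma_algebra_bigcup => m.
apply: sigma_algebraC; apply: sub_sigma_algebra => /=.
apply: openU; first exact: open_not_unit_cube.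
apply: bigcup_open => r /= /andP[r0 _].
by apply: open_ball_ratio => //; rewrite invr_gt0.
Qed.

End density_points_borel.

(** * Almost Horn theories *)

Lemma subset_image_inj (U V : finType) (f : U -> V) :
  injective f -> injective (subset_image f).
Proof.
by move=> finj A B /(congr1 val)/= /(imset_inj finj) AB; exact: val_inj.
Qed.

Lemma clause_formulaP (L : language) (V : Type) (M : structure L V) (n : nat)
    (v : 'I_n -> V) (c : seq (literal L n)) :
  holds M v (clause_formula c) <->
  exists2 l, List.In l c & holds M v (literal_formula l).
Proof.
elim: c => [|l c ih] /=; first by split => // -[].
split=> [[h|/ih[k kc h]]|[k [<-|kc] h]].
- by exists l => //; left.
- by exists k => //; right.
- by left.
- by right; apply/ih; exists k.
Qed.

Lemma count_le1_inj (X : Type) (p : pred X) (c : seq X) k l : (count p c <= 1)%N ->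
  List.In k c -> List.In l c -> p k -> p l -> k = l.
Proof.
have pos d m : List.In m d -> p m -> (0 < count p d)%N.
  elim: d => //= z d ih [->|md] pm; first by rewrite pm.
  by rewrite addn_gt0 ih ?orbT.
elim: c => //= z c ih h [zk|kc] [zl|lc] pk pl.
- by rewrite -zk -zl.
- by move: h; rewrite zk pk add1n ltnS leqNgt (pos _ _ lc pl).
- by move: h; rewrite zl pl add1n ltnS leqNgt (pos _ _ kc pk).
- by apply: ih => //; apply: leq_trans h; rewrite leq_addl.
Qed.

(** For [y] in the cube, this is the only canonical structure [M] with [y] in [Tind M N]. *)
Definition induced_structure (R : realType) (L : language)
    (N : predicate_sets R L) (V : finType) (y : ambient R V) : structure L V :=
  fun P => [set alpha | injective alpha /\ N P (pullback alpha y)].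

Lemma canonical_induced_structure (R : realType) (L : language)
    (N : predicate_sets R L) (V : finType) (y : ambient R V) :
  canonical_structure (induced_structure N y).
Proof. by move=> P t []. Qed.

Lemma Tind_induced_structure (R : realType) (L : language)
    (N : predicate_sets R L) (V : finType) (y : ambient R V) :
  unit_cube y -> Tind (induced_structure N y) N y.
Proof.
move=> yU; split => // P _; split => alpha [ainj h]; first by case: h.
split; first by move=> A; exact: yU.
by move=> Ny; apply: h; split.
Qed.

Lemma lambda_not_model (R : realType) (L : language) (T : theory L)
    (N : predicate_sets R L) (V : finType) : weak_on T N ->
  lambda (unit_cube `&` [set y : ambient R V | ~ is_model (induced_structure N y) T])
    = 0%E.
Proof.
move=> [_ wT].
pose code := {P : L & {ffun 'I_(arity P) -> V}}.
(* Boolean tables over the finite type [code] represent every structure on [V], which makes the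
   union of null sets below countable. *)
pose decode (m : {ffun code -> bool}) : structure L V := fun P => [set alpha |
  m (Tagged (fun P : L => {ffun 'I_(arity P) -> V}) (finfun alpha))].
pose F m := if `[< canonical_structure (decode m) /\ ~ is_model (decode m) T >]
  then Tind (decode m) N else set0.
apply: (@lambda_nullS _ _ _ (\bigcup_m F m)); last first.
  apply: lambda_null_bigcup => m; rewrite /F; case: asboolP => [[h1 h2]|_].
    exact: wT.
  exact: lambda0.
move=> y [yU nT].
pose m := [ffun p : code => `[< induced_structure N y (tagged p) >]].
have E : decode m = induced_structure N y.
  apply: functional_extensionality_dep => P; apply/seteqP.
  have fE (alpha : 'I_(arity P) -> V) : (finfun alpha : _ -> _) = alpha.
    by apply/funext => i; rewrite ffunE.
  by split => alpha; rewrite /decode/= ffunE /= fE => /asboolP.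
exists m => //; rewrite /F E; case: asboolP => [_|h].
  exact: Tind_induced_structure.
by exfalso; apply: h; split => //; exact: canonical_induced_structure.
Qed.

Lemma thin_pullback (R : realType) (k : nat) (V : finType) (alpha : 'I_k -> V)
    (x : ambient R V) (A : set (ambient R 'I_k)) :
  injective alpha -> unit_cube x ->
  thin A (pullback alpha x) <-> thin (pullback alpha @^-1` A) x.
Proof. by move=> ainj; exact: thin_preimage (subset_image_inj ainj). Qed.

Lemma Tind_density_points_not_model (R : realType) (L : language) (T : theory L)
    (N : predicate_sets R L) (V : finType) (M : structure L V) :
  almost_horn_theory T -> weak_on T N ->
  canonical_structure M -> ~ is_model M T ->
  Tind M (fun P => density_points (N P)) = set0.
Proof.
move=> [_ hornT] wT Mcan /existsNP[S /not_implyP[TS]].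
have [n [c [hc SE]]] := hornT S TS; subst S; move=> /existsNP[v /=] nc.
have {}nc l : List.In l c -> ~ holds M v (literal_formula l).
  by move=> lc h; apply: nc; apply/clause_formulaP; exists l.
have [eN _] := wT.
apply/seteqP; split => // x [xU hx].
(* [missing] collects the points at which a relational hypothesis of the clause fails for [N],
   [derived] those at which a relational conclusion holds. Equality literals contribute nothing:
   their truth depends on [v] alone, so they are false in every structure as they are in [M]. *)
pose missing (l : literal L n) : set (ambient R V) :=
  if l is Literal false (RelAtom P t) then pullback (v \o t) @^-1` ~` N P else set0.
pose derived (l : literal L n) : set (ambient R V) :=
  if l is Literal true (RelAtom P t)
  then [set y | induced_structure N y (v \o t)] else set0.
pose B := [set y | exists2 l, List.In l c & missing l y]
  `|` [set y | ~ is_model (induced_structure N y) T].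
have thinB : thin B x.
  apply: thinU; last by apply: thin_null; exact: lambda_not_model.
  apply: thin_bigcup_list => l lc.
  have thin0 : thin (set0 : set (ambient R V)) x.
    by apply: thin_null; rewrite setI0 lambda0.
  have := nc l lc; case: l {lc} => -[] [P t|i j] //=.
  rewrite /literal_formula/= => /contrapT Mt.
  have tinj := Mcan _ _ Mt.
  apply/(thin_pullback _ tinj xU).
  have [hpos _] := hx P I.
  have /(density_pointsP _ (eN P).1 (eN P).2)[//] :
    density_points (N P) (pullback (v \o t) x) by apply: hpos; split.
(* Outside [B] the induced structure satisfies the clause although its hypotheses hold and its
   equality literals are false, so a relational conclusion must hold. *)
have coverB y : unit_cube y -> (forall l, List.In l c -> ~ derived l y) -> B y.
  move=> yU nd; have [?|nm] := pselect (exists2 l, List.In l c & missing l y); [by left|right].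
  move=> /(_ _ TS) /= /(_ v); rewrite /= => /clause_formulaP[l lc].
  have := nd l lc; have := nc l lc.
  have : ~ missing l y by move=> h; apply: nm; exists l.
  case: l {lc} => -[] [P t|i j] //=.
  rewrite /literal_formula /= => /contrapT Ny /contrapT Mt _; apply.
  by split => //; exact: Mcan Mt.
(* A conclusion on a tuple with repeated vertices is never derived, because induced structures are
   canonical; it counts as no conclusion. *)
have [[[P t]]|nl] := pselect (exists Pt : {P : L & 'I_(arity P) -> 'I_n},
   List.In (Literal true (RelAtom (projT1 Pt) (projT2 Pt))) c /\
   injective (v \o projT2 Pt)).
  move=> /= [lc tinj].
  have nMt : ~ M P (v \o t) by move: (nc _ lc).
  have [_ hneg] := hx P I; have [_] := hneg (v \o t) (conj tinj nMt); apply.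
  apply/density_pointsP; [exact: (eN P).1|exact: (eN P).2|].
  split; first by move=> A; exact: xU.
  (* Every cube point where the conclusion fails for [N] lies in [B]: by the Horn condition, any
     derived literal would be this same conclusion. *)
  apply/(thin_pullback _ tinj xU); apply: thinS thinB => y [yU nNy].
  apply: coverB => // l lc'.
  have [dl|//] := pselect (derived l y).
  have E : l = Literal true (RelAtom P t).
    apply: (count_le1_inj hc lc' lc) => //.
    by move: dl; case: l {lc'} => -[] [].
  by rewrite E /= => -[_ Ny]; exact: nNy.
(* With nothing to derive, [B] contains the whole cube, which is not thin at [x]. *)
apply: (not_thin_cube xU); apply: thinS thinB => y [yU _]; apply: coverB => // l lc.
case: l lc => -[] [P t|i j] /= lc => [[tinj _]|[]|[]|[]].
by apply: nl; exists (existT _ P t).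
Qed.

(** Off the pullbacks of the symmetric differences along injections, which are null and finite in
    number, [N] and [N'] agree on every condition in [Tind]. Exchanging them gives equality. *)
Lemma le_lambda_Tind (R : realType) (L : language) (N N' : predicate_sets R L)
    (V : finType) (M : structure L V) :
  (forall P, N' P `<=` unit_cube) -> (forall P, lambda (N P `+` N' P) = 0%E) ->
  (lambda (Tind M N) <= lambda (Tind M N'))%E.
Proof.
move=> N'U NN'.
pose code := {P : L & {ffun 'I_(arity P) -> V}}.
pose Z (p : code) : set (ambient R V) := if `[< injective (tagged p) >]
  then unit_cube `&` pullback (tagged p) @^-1` (N (tag p) `+` N' (tag p)) else set0.
have Z0 : lambda (\bigcup_p Z p) = 0%E.
  apply: lambda_null_bigcup => p; rewrite /Z; case: asboolP => [pinj|_]; last exact: lambda0.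
  apply: (lambda_preimage_null (subset_image_inj pinj)).
  by apply: lambda_nullS (NN' (tag p)); exact: subIsetr.
apply: (@le_trans _ _ (lambda (Tind M N' `|` \bigcup_p Z p))); last first.
  by apply: le_trans (outer_measureU2 _ _ _) _; rewrite /= Z0 adde0.
apply: le_lambda => y [yU hy].
have [Zy|nZ] := pselect ((\bigcup_p Z p) y); [by right|left].
have same P (alpha : 'I_(arity P) -> V) : injective alpha ->
    N P (pullback alpha y) <-> N' P (pullback alpha y).
  move=> ainj.
  have fE : (finfun alpha : _ -> _) = alpha by apply/funext => i; rewrite ffunE.
  have nZp : ~ (N P `+` N' P) (pullback alpha y).
    move=> h; apply: nZ.
    exists (Tagged (fun P : L => {ffun 'I_(arity P) -> V}) (finfun alpha)) => //.
    by rewrite /Z /= fE; case: asboolP.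
  by split=> h; apply: contrapT => nh; apply: nZp; [left|right].
split => // P _; have [h1 h2] := hy P I; split => alpha ha.
  by apply/same; [exact: ha.1|exact: h1].
have [aU nN] := h2 alpha ha; split => // N'a; apply: nN.
by apply/same => //; exact: ha.1.
Qed.

Theorem theorem4p5 (R : realType) (L : language) (T : theory L)
    (N : predicate_sets R L) :
  almost_horn_theory T -> weak_on T N ->
  let N' : predicate_sets R L := fun P => density_points (N P) in
  [/\ strong_on T N',
      borel_structure N',
      (forall P : L, lambda (N P `+` N' P) = 0%E) &
      (forall (V : finType) (M : structure L V),
         is_model M T -> density M N = density M N')].
Proof.
move=> hornT wT N'; have [eN _] := wT.
have N'U P : N' P `<=` unit_cube by move=> x [].
have sym P : lambda (N P `+` N' P) = 0%E.
  exact: density_points_symdiff (eN P).1 (eN P).2.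
split => //.
- split.
    by move=> P; split => //; apply: lebesgue_measurable_density_points; case: (eN P).
  by move=> V M Mcan nM; rewrite (Tind_density_points_not_model hornT wT Mcan nM).
- by move=> P; apply: borel_density_points; case: (eN P).
- move=> V M _; rewrite /density; congr (_ * _)%E.
  apply/eqP; rewrite eq_le; apply/andP; split; apply: le_lambda_Tind => // P.
    by case: (eN P).
  by rewrite setYC.
Qed.
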